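(* Fix $t\ge0$ and let $x\in(0,1)$ satisfy $x+F_t(r-cx)=1$. Let $\alpha:=cf_t(r-cx)$ and assume that $\alpha>1$. Then $$\lim_{\varepsilon\to0}\lim_{n\to\infty}P\big(\exists\,k\in\mathcal{K}^*_{n,t}:\ |x-\tfrac{k}{n}|<\varepsilon\big)=\frac{1-\theta}{\alpha-1}<1,$$ where $\theta\in(0,1)$ is defined through $\theta e^{-\theta}=\alpha e^{-\alpha}$.
   Context: $r\in\mathbb{R}$ and $c>0$ are constants. For the fixed time $t$, the signals $Y^1_t,Y^2_t,\dots$ are i.i.d. $[0,\infty)$-valued random variables on a probability space $(\Omega,\mathcal{G},P)$ with c.d.f. $F_t(y)=P\{Y^i_t\le y\}$, which is assumed to admit a continuous density $f_t$. For $n\ge1$ and integers $k$, set $$G_{n,t}(k)=\#\{i\in\{1,\dots,n\}:\ Y^i_t+c\tfrac{k}{n}\ge r\},$$ and define the random set $$\mathcal{K}^*_{n,t}=\{0\le k\le n:\ G_{n,t}(k)=k\}.$$ *)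

(* Defs.v *)
From HB Require Import structures.
From mathcomp Require Import all_boot all_order all_algebra.
From mathcomp Require Import all_classical all_reals all_analysis.
Set Implicit Arguments.
Unset Strict Implicit.
Unset Printing Implicit Defensive.
Import Order.TTheory GRing.Theory Num.Theory.
Import numFieldNormedType.Exports.
Local Open Scope classical_set_scope.
Local Open Scope ring_scope.

(** Mutual independence: the product rule over every finite set of indices,
    given as a duplicate-free sequence [s]. *)
Definition independent_RVs (d : measure_display) (T : measurableType d)
    (R : realType) (P : probability T R) (Y : nat -> {RV P >-> R}) : Prop :=
  forall (s : seq nat) (A : nat -> set R), uniq s ->
    (forall i, measurable (A i)) ->
    P (\bigcap_(i in [set` s]) (Y i @^-1` A i)) =
      (\prod_(i <- s) P (Y i @^-1` A i))%E.

Definition identically_distributed (d : measure_display)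
    (T : measurableType d) (R : realType) (P : probability T R)
    (Y : nat -> {RV P >-> R}) : Prop :=
  forall (i j : nat) (A : set R), measurable A ->
    distribution P (Y i) A = distribution P (Y j) A.

Definition iid_RVs (d : measure_display) (T : measurableType d)
    (R : realType) (P : probability T R) (Y : nat -> {RV P >-> R}) : Prop :=
  independent_RVs Y /\ identically_distributed Y.

(** Continuity is only required on the half-line carrying the law of a
    [[0, +oo[]]-valued variable, so that, e.g., exponential densities (which
    jump at 0) qualify. *)
Definition continuous_density (R : realType) (F : R -> \bar R) (f : R -> R)
    : Prop :=
  [/\ measurable_fun setT f,
      (forall u, 0 <= f u),
      {within `[0, +oo[, continuous f} &
      forall y, F y = (\int[lebesgue_measure]_(u in `]-oo, y]) (f u)%:E)%E].

(** The signals are 0-indexed: [Y i] is the (i+1)-st signal. *)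
Definition G (T : Type) (R : realType) (r c : R) (Y : nat -> T -> R) (n : nat)
    (k : int) (w : T) : nat :=
  #|[pred i : 'I_n | r <= Y i w + c * (k%:~R / n%:R)]|.

Definition Kstar (T : Type) (R : realType) (r c : R) (Y : nat -> T -> R)
    (n : nat) (w : T) : set int :=
  [set k : int | 0 <= k <= n%:Z /\ (G r c Y n k w)%:Z = k].

Definition near_event (T : Type) (R : realType) (r c : R) (Y : nat -> T -> R)
    (x : R) (n : nat) (eps : R) : set T :=
  [set w | exists2 k : int, Kstar r c Y n w k & `|x - k%:~R / n%:R| < eps].

(* Main.v *)
Require Import Defs.
From HB Require Import structures.
From mathcomp Require Import all_boot all_order all_algebra.
From mathcomp Require Import all_classical all_reals all_analysis.
From mathcomp Require Import ring lra zify unstable measurable_realfun.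
Set Implicit Arguments.
Unset Strict Implicit.
Unset Printing Implicit Defensive.
Import Order.TTheory GRing.Theory Num.Theory.
Import numFieldNormedType.Exports.
Local Open Scope classical_set_scope.
Local Open Scope ring_scope.

(** Write [pi y] for the probability that a signal is at least [r - c y], so that
    the count [G(k)] is binomial with parameters [n] and [pi (k/n)]. The point [x]
    is a fixed point of [pi], with slope [alpha > 1] there, and for [k/n] near [x]
    the process [G(k) - k] resembles a random walk whose steps are a Poisson
    variable of mean [alpha] minus 1: it starts far below 0, ends far above 0,
    goes down by at most 1 at a time, but may jump over 0. A hit is an index [k]
    of the window around [x] with [G(k) = k].

    The expected number of hits tends to [1/(alpha - 1)] ([window_hit_mass_cvg]).
    Indeed, the probability of [G(k) > k] climbs from 0 to 1 across the window,
    and by the mean value theorem applied to the binomial tail as a polynomial in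
    its parameter, one step raises it by about [(alpha - 1) P(G(k) = k)]
    ([crossing_rate]): the gain is [alpha P(G(k) = k)] because more signals are
    counted, the loss is [P(G(k) = k + 1)] because the level moves up. Telescoping
    gives the sum of the [P(G(k) = k)].

    Given that the last hit is at [l], the [l] signals counted at [l] are i.i.d.,
    so [k <= l] is also a hit with the binomial probability of parameters [l] and
    [pi (k/n) / pi (l/n)] ([last_hit_decomposition]). As [n] grows, the sum over
    [k] of these probabilities tends to the sum over [j] of
    [(alpha j)^j exp(-alpha j) / j!], for [j = l - k]. This series depends on
    [alpha] only through [alpha exp(-alpha)], which equals
    [theta exp(-theta)]; and for [theta < 1] it is the limit of the sums over [j]
    of the binomial probabilities of [j] with parameters [m] and [theta j / m],
    which Abel's identity turns into sums close to the geometric series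
    [1/(1 - theta)] ([sum_returns_supercritical]).

    Hence the expected number of hits is about [P(a hit exists) / (1 - theta)],
    and [P(a hit exists)] tends to [(1 - theta)/(alpha - 1)] for every window
    small enough, not only in the limit of small windows ([hits_cvg]).

    The conditioning on the last hit is carried out on finite sums: each signal is
    replaced by the least [k] at which it is counted, and the events become sets
    of functions with finite domain and codomain ([prob_near_event]). *)

(** * Binomial probabilities and tails *)

Definition binomial_tail (R : realType) (n : nat) (p : R) (m : nat) : R :=
  \sum_(m <= j < n.+1) binomial_pmf n p j.

(** The probability generating function of the binomial distribution. *)
Lemma sum_binomial_pmf_expr (R : realType) (n : nat) (p z : R) :
  \sum_(j < n.+1) binomial_pmf n p j * z ^+ j = (1 - p + p * z) ^+ n.
Proof.
rewrite exprDn; apply: eq_bigr => j _.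
rewrite /binomial_pmf /onem exprMn mulrnAl; congr (_ *+ _).
by rewrite [p ^+ j * _]mulrC -mulrA.
Qed.

Lemma sum_binomial_pmf (R : realType) (n : nat) (p : R) :
  \sum_(j < n.+1) binomial_pmf n p j = 1.
Proof.
have := sum_binomial_pmf_expr n p 1; rewrite mulr1 subrK expr1n => <-.
by apply: eq_bigr => j _; rewrite expr1n mulr1.
Qed.

Lemma binomial_pmf_le1 (R : realType) (n j : nat) (p : R) :
  0 <= p <= 1 -> binomial_pmf n p j <= 1.
Proof.
move=> p01; case: (leqP j n) => [jn|nj]; last first.
  by rewrite /binomial_pmf bin_small // mulr0n.
rewrite -(sum_binomial_pmf n p) (bigD1 (Ordinal (jn : j < n.+1)%N)) //= lerDl.
by apply: sumr_ge0 => i _; exact: binomial_pmf_ge0.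
Qed.

Lemma binomial_tail_le1 (R : realType) (n m : nat) (p : R) :
  0 <= p <= 1 -> 0 <= binomial_tail n p m <= 1.
Proof.
move=> p01; have b0 j := binomial_pmf_ge0 n j p01.
apply/andP; split; first exact: sumr_ge0.
rewrite -(sum_binomial_pmf n p) -(big_mkord xpredT (binomial_pmf n p)).
case: (leqP m n.+1) => [mn|nm]; last first.
  by rewrite /binomial_tail (big_geq (ltnW nm)) sumr_ge0.
by rewrite [leRHS](big_cat_nat (leq0n m) mn) //= lerDr sumr_ge0.
Qed.

(** Exponential Markov inequality with the generating function at [1 + h]. *)
Lemma chernoff_upper (R : realType) (n m : nat) (p h : R) :
  0 <= p <= 1 -> 0 <= h ->
  binomial_tail n p m <= expR (h * (n%:R * p - m%:R / (1 + h))).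
Proof.
move=> p01 h0; have b0 j := binomial_pmf_ge0 n j p01.
have h1 : 0 < 1 + h by lra.
have e1 : (1 + h)^-1 <= expR (- (h / (1 + h))).
  apply: le_trans (expR_ge1Dx _); rewrite le_eqVlt; apply/orP; left; apply/eqP.
  by field; lra.
have := sum_binomial_pmf_expr n p (1 + h).
move=> E; have {E} : binomial_tail n p m * (1 + h) ^+ m <= expR (h * (n%:R * p)).
  have -> : expR (h * (n%:R * p)) = expR (h * p) ^+ n.
    by rewrite mulrCA -expRM_natl.
  apply: (@le_trans _ _ ((1 - p + p * (1 + h)) ^+ n)); last first.
    apply: lerXn2r; rewrite ?nnegrE; last first.
    - by apply: le_trans (expR_ge1Dx _); lra.
    - exact: expR_ge0.
    - by nra.
  rewrite -E -(big_mkord xpredT (fun j => binomial_pmf n p j * (1 + h) ^+ j)).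
  rewrite /binomial_tail.
  have t0 j : 0 <= binomial_pmf n p j * (1 + h) ^+ j.
    by rewrite mulr_ge0 // exprn_ge0 // ltW.
  case: (leqP m n.+1) => [mn|nm]; last first.
    by rewrite (big_geq (ltnW nm)) mul0r sumr_ge0.
  rewrite [leRHS](big_cat_nat (leq0n m) mn) //= big_distrl /=.
  apply: ler_wpDl; first exact: sumr_ge0.
  rewrite big_nat_cond [leRHS]big_nat_cond; apply: ler_sum => j /andP[/andP[mj _] _].
  by rewrite ler_wpM2l // ler_weXn2l //; lra.
rewrite -ler_pdivlMr ?exprn_gt0 // => /le_trans; apply.
rewrite mulrBr expRD ler_wpM2l ?expR_ge0 //.
rewrite -exprVn.
have -> : - (h * (m%:R / (1 + h))) = m%:R * (- (h / (1 + h))) by ring.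
rewrite expRM_natl; apply: lerXn2r => //; rewrite ?nnegrE ?expR_ge0 //.
by rewrite invr_ge0 ltW.
Qed.

Lemma binomial_pmf_rev (R : realType) (n j : nat) (p : R) : (j <= n)%N ->
  binomial_pmf n p j = binomial_pmf n (1 - p) (n - j).
Proof.
move=> jn; rewrite /binomial_pmf bin_sub // subKn //.
by rewrite -/(onem p) onemK [in LHS]mulrC.
Qed.

(** The upper tail bound applied to the number of failures. *)
Lemma chernoff_lower (R : realType) (n m : nat) (p h : R) :
  0 <= p <= 1 -> 0 <= h -> (m <= n.+1)%N ->
  1 - binomial_tail n p m <=
    expR (h * (n%:R * (1 - p) - (n.+1 - m)%:R / (1 + h))).
Proof.
move=> p01 h0 mn.
have -> : 1 - binomial_tail n p m = binomial_tail n (1 - p) (n.+1 - m).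
  rewrite -[X in X - _](sum_binomial_pmf n p) -(big_mkord xpredT (binomial_pmf n p)).
  rewrite /binomial_tail (big_cat_nat (leq0n m) mn) //= addrK.
  rewrite -{1}[(n.+1 - m)%N]add0n big_addn subKn // [RHS]big_nat_rev /=.
  apply: eq_big_nat => i /andP[_ im].
  rewrite binomial_pmf_rev; last by lia.
  by congr binomial_pmf; lia.
by apply: chernoff_upper => //; lra.
Qed.

(** The derivative in [p] of the tail telescopes to a single term: the derivative of
    [P(Bin(n+1, p) = j)] is [n+1] times the difference of [P(Bin(n, p) = j - 1)] and
    [P(Bin(n, p) = j)]. *)
Lemma binomial_tail_MVT (R : realType) (n m : nat) (p q : R) :
  (m <= n)%N -> p <= q ->
  exists2 xi, p <= xi <= q &
    binomial_tail n.+1 q m.+1 - binomial_tail n.+1 p m.+1 =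
      n.+1%:R * binomial_pmf n xi m * (q - p).
Proof.
move=> mn pq.
pose B n k : {poly R} := ('X^k * (1 - 'X) ^+ (n - k)) *+ 'C(n, k).
have BE k l t : (B k l).[t] = binomial_pmf k t l.
  by rewrite /B hornerMn hornerM horner_exp hornerX horner_exp !hornerE.
pose TT : {poly R} := \sum_(m <= j < n.+1) B n.+1 j.+1.
have TE t : TT.[t] = binomial_tail n.+1 t m.+1.
  rewrite /TT /binomial_tail [RHS]big_add1 /= horner_sum.
  by apply: eq_bigr => j _; rewrite BE.
have dB k : (k <= n)%N -> (B n.+1 k.+1)^`() = (B n k - B n k.+1) *+ n.+1.
  move=> kn; rewrite /B derivMn derivM derivXn deriv_exp derivB derivX derivC sub0r /=.
  have E1 := mul_bin_diag n.+1 k.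
  have E2 : (n.+1 * 'C(n, k.+1) = (n - k) * 'C(n.+1, k.+1))%N.
    by have := mul_bin_left n.+1 k.+1; rewrite subSS => <-; rewrite (mul_bin_diag n.+1).
  rewrite mulrnBl -!mulrnA [('C(n, k) * _)%N]mulnC [('C(n, k.+1) * _)%N]mulnC.
  rewrite E1 E2 subSS mulrnDl -subnS; congr (_ + _).
    by rewrite mulrnAl -mulrnA mulnC.
  by rewrite mulN1r mulNrn mulrN mulNrn mulrnAr -mulrnA mulnC.
have dT : TT^`() = B n m *+ n.+1.
  rewrite /TT raddf_sum /=.
  rewrite (eq_big_nat _ _
    (F2 := fun i => (- B n i.+1 *+ n.+1) - (- B n i *+ n.+1))); last first.
    by move=> i /andP[_ i_n]; rewrite dB // mulrnBl !mulNrn opprK addrC.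
  rewrite telescope_sumr; last by rewrite leqW.
  by rewrite {1}/B bin_small // mulr0n oppr0 mul0rn sub0r mulNrn opprK.
have [] := @MVT_segment R (horner TT) (horner TT^`()) p q pq.
  by apply: continuous_subspaceT; exact: continuous_horner.
move=> xi; rewrite in_itv /= => xipq; rewrite !TE dT => ->.
by exists xi => //; rewrite hornerMn BE mulr_natl.
Qed.

(** With [s = j/m], the probability of [j] at the parameter [s] is at most 1, and changing
    the parameter from [s] to [beta s] costs the factor
    [beta^j ((1 - beta s)/(1 - s))^(m - j)], where [1 + z <= exp z] applies. The ratio
    [beta exp(1 - beta)] is below 1 unless [beta = 1], so the bound dominates both the
    supercritical and the subcritical sums. *)
Lemma binomial_pmf_le_geo (R : realType) (m j : nat) (beta : R) :
  (0 < m)%N -> (j <= m)%N -> 0 <= beta -> beta * j%:R <= m%:R ->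
  binomial_pmf m (beta * j%:R / m%:R) j <= (beta * expR (1 - beta)) ^+ j.
Proof.
move=> m0 jm b0 bm; have m0' : (0 : R) < m%:R by rewrite ltr0n.
have [->|j0] := posnP j.
  by rewrite mulr0 mul0r /binomial_pmf onem0 expr1n mulr1 bin0 !expr0.
have jR : (0 : R) < j%:R by rewrite ltr0n.
move: jm; rewrite leq_eqVlt => /orP[/eqP jm|jm].
  rewrite -jm mulfK ?gt_eqF // /binomial_pmf subnn expr0 mulr1 binn mulr1n.
  have b1 : beta <= 1 by rewrite -(ler_pM2r jR) mul1r {2}jm.
  apply: lerXn2r; rewrite ?nnegrE ?mulr_ge0 ?expR_ge0 // ler_peMr //.
  by have := expR_ge1Dx (1 - beta); lra.
pose s : R := j%:R / m%:R; pose q := beta * s.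
have s01 : 0 < s < 1 by rewrite /s divr_gt0 //= ltr_pdivrMr // mul1r ltr_nat.
rewrite -mulrA -/s -/q.
have q1 : q <= 1 by rewrite /q /s mulrA ler_pdivrMr // mul1r.
have -> : binomial_pmf m q j =
    binomial_pmf m s j * (beta ^+ j * ((1 - q) / (1 - s)) ^+ (m - j)).
  rewrite /binomial_pmf /onem {1}/q exprMn.
  rewrite [((1 - q) / (1 - s)) ^+ _]expr_div_n mulrnAl.
  rewrite -[LHS]mulr_natr -[RHS]mulr_natr.
  have : (1 - s) ^+ (m - j) != 0 by rewrite expf_neq0 // gt_eqF //; lra.
  move: ((1 - s) ^+ (m - j)) (beta ^+ j) (s ^+ j) ((1 - q) ^+ (m - j)) ('C(m, j)%:R)
    => V A B U C V0.
  by field.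
apply: (@le_trans _ _ (beta ^+ j * ((1 - q) / (1 - s)) ^+ (m - j))).
  rewrite ler_piMl // ?binomial_pmf_le1 //; last by lra.
  by rewrite mulr_ge0 ?exprn_ge0 // divr_ge0; lra.
rewrite [(beta * _) ^+ j]exprMn ler_wpM2l ?exprn_ge0 //.
have -> : expR (1 - beta) ^+ j = expR ((s - q) / (1 - s)) ^+ (m - j).
  rewrite -!expRM_natl natrB ?(ltnW jm) //; congr expR.
  rewrite /q /s; field; rewrite ?gt_eqF //=.
  by rewrite subr_gt0 ltr_nat.
apply: lerXn2r; rewrite ?nnegrE ?expR_ge0 ?divr_ge0 //; try lra.
apply: le_trans (expR_ge1Dx _); rewrite le_eqVlt; apply/orP; left; apply/eqP.
by field; lra.
Qed.

(** * Abel's identity and the expected number of returns *)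

(** The finite difference of order [N] of a monomial of degree [d <= N]. Absorbing a factor
    [j] into the binomial coefficient lowers [N] by one. *)
Lemma sum_binomial_alternating (R : comNzRingType) (N d : nat) : (d <= N)%N ->
  \sum_(j < N.+1) 'C(N, j)%:R * ((-1) ^+ (N - j) * j%:R ^+ d) =
    (if d == N then N`!%:R else 0) :> R.
Proof.
elim: N d => [|N IH] [|d] //=.
- by move=> _; rewrite big_ord1 /= !expr0 !mulr1 bin0.
- move=> _; have := exprDn (-1 : R) 1 N.+1; rewrite addNr expr0n /= => E.
  apply/esym; rewrite [LHS]E.
  by apply: eq_bigr => j _; rewrite expr1n expr0 mulr_natl.
rewrite ltnS eqSS => dN; rewrite big_ord_recl /= expr0n /= !mulr0 add0r.
transitivity (N.+1%:R * \sum_(e < d.+1) 'C(d, e)%:R *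
    (\sum_(j < N.+1) 'C(N, j)%:R * ((-1) ^+ (N - j) * j%:R ^+ e)) : R).
  under [in RHS]eq_bigr do rewrite big_distrr /=.
  rewrite exchange_big /= big_distrr /=; apply: eq_bigr => j _.
  rewrite /bump /= add1n subSS exprS.
  have -> : 'C(N.+1, j.+1)%:R * ((-1) ^+ (N - j) * (j.+1%:R * j.+1%:R ^+ d)) =
     (j.+1 * 'C(N.+1, j.+1))%:R * ((-1) ^+ (N - j) * j.+1%:R ^+ d) :> R.
    by rewrite natrM; ring.
  rewrite -mul_bin_diag natrM -!mulrA; congr (_ * _).
  rewrite -[in LHS](addn1 j) natrD exprDn !big_distrr /=.
  rewrite (reindex_inj rev_ord_inj) /=; apply: eq_bigr => e _.
  have ed : (e <= d)%N by rewrite -ltnS.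
  rewrite subSS bin_sub // subKn // expr1n mulr1 -[_ *+ 'C(d, e)]mulr_natr.
  by ring.
rewrite big_ord_recr /= binn mul1r big1 => [|e _].
  rewrite add0r IH //; case: (d == N); last by rewrite mulr0.
  by rewrite -natrM factS.
rewrite IH; last by apply: leq_trans dN; apply: ltnW.
by rewrite ltn_eqF ?mulr0 //; apply: leq_trans dN.
Qed.

Lemma mul_bin_assoc (m N j : nat) : (j <= N)%N -> (N <= m)%N ->
  ('C(m, j) * 'C(m - j, N - j) = 'C(m, N) * 'C(N, j))%N.
Proof.
move=> jN Nm; have jm := leq_trans jN Nm.
apply/eqP; rewrite -(eqn_pmul2r (fact_gt0 j)) -(eqn_pmul2r (fact_gt0 (N - j))).
rewrite -(eqn_pmul2r (fact_gt0 (m - N))); apply/eqP.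
have e1 := bin_fact jm; have e2 := bin_fact Nm; have e3 := bin_fact jN.
have : (N - j <= m - j)%N by lia.
move/bin_fact; have -> : (m - j - (N - j) = m - N)%N by lia.
move: e1 e2 e3.
move: ('C(m, j)) ('C(m, N)) ('C(N, j)) ('C(m - j, N - j)) => a b c e.
move: (m`!) (j`!) (N`!) ((m - j)`!) ((N - j)`!) ((m - N)`!) => fm fj fN fmj fNj fmN.
move=> e1 e2 e3 e4; nia.
Qed.

(** Expanding [(1 - j z)^(m - j)] and collecting the powers of [z], the coefficient of [z^N]
    is a binomial coefficient times a finite difference of order [N] of [j^N], that is [N!]. *)
Lemma abel_identity (R : comNzRingType) (m : nat) (z : R) :
  \sum_(j < m.+1) 'C(m, j)%:R * ((j%:R * z) ^+ j * (1 - j%:R * z) ^+ (m - j)) =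
  \sum_(N < m.+1) (m ^_ N)%:R * z ^+ N.
Proof.
transitivity (\sum_(j < m.+1) \sum_(N < m.+1 | (j <= N)%N)
   ('C(m, N)%:R * z ^+ N) * ('C(N, j)%:R * ((-1) ^+ (N - j) * (j%:R ^+ N)))).
  apply: eq_bigr => j _.
  have jm : (j <= m)%N by rewrite -ltnS.
  rewrite exprDn !big_distrr /=.
  rewrite -(big_mkord xpredT (fun i : nat => 'C(m, j)%:R * ((j%:R * z) ^+ j *
    (1 ^+ (m - j - i) * (- (j%:R * z)) ^+ i *+ 'C(m - j, i))))).
  rewrite -(big_mkord (fun N => (j <= N)%N) (fun N : nat => ('C(m, N)%:R * z ^+ N) *
     ('C(N, j)%:R * ((-1) ^+ (N - j) * j%:R ^+ N)))).
  rewrite [RHS](big_cat_nat (leq0n j)) /=; last by rewrite ltnW.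
  rewrite [X in _ = X + _]big_nat_cond [X in _ = X + _]big1 ?add0r; last first.
    by move=> i /andP[/andP[_ ij]]; rewrite leqNgt ij.
  have shift (F : nat -> R) : \sum_(j <= i < m.+1 | (j <= i)%N) F i =
      \sum_(0 <= i < (m - j).+1) F (i + j)%N.
    rewrite -{1}[j : nat]add0n big_addn subSn // big_mkcond /=.
    by apply: eq_bigr => i _; rewrite leq_addl.
  rewrite shift; apply: eq_big_nat => i /andP[_ im].
  rewrite expr1n mul1r addnK -[_ *+ 'C(m - j, i)]mulr_natr.
  have := @mul_bin_assoc m (i + j) j (leq_addl _ _); rewrite addnK => H.
  have {}H : 'C(m, j)%:R * 'C(m - j, i)%:R = 'C(m, i + j)%:R * 'C(i + j, j)%:R :> R.
    by rewrite -!natrM H //; lia.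
  rewrite !exprD [(- (_ * _)) ^+ i]exprNn !exprMn.
  transitivity (('C(m, j)%:R * 'C(m - j, i)%:R) *
    ((j%:R ^+ j * z ^+ j) * ((-1) ^+ i * (j%:R ^+ i * z ^+ i))) : R); first by ring.
  by rewrite H; ring.
rewrite (exchange_big_dep xpredT) //=; apply: eq_bigr => N _.
rewrite -big_distrr /=.
have := @sum_binomial_alternating R N N (leqnn N); rewrite eqxx => S.
have -> : \sum_(j < m.+1 | (j <= N)%N) 'C(N, j)%:R * ((-1) ^+ (N - j) * j%:R ^+ N) =
   N`!%:R :> R.
  rewrite -S (big_ord_widen_cond m.+1 xpredT
    (fun j => 'C(N, j)%:R * ((-1) ^+ (N - j) * j%:R ^+ N) : R)) //.
by rewrite mulrAC -natrM bin_ffact.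
Qed.

Lemma binomial_pmfE (R : realType) (n j : nat) (p : R) :
  binomial_pmf n p j = 'C(n, j)%:R * (p ^+ j * (1 - p) ^+ (n - j)).
Proof. by rewrite /binomial_pmf mulr_natl. Qed.

Lemma sum_binomial_pmf_abel (R : realType) (m : nat) (t : R) :
  \sum_(0 <= j < m.+1) binomial_pmf m (t * j%:R / m%:R) j =
  \sum_(0 <= N < m.+1) (m ^_ N)%:R / m%:R ^+ N * t ^+ N.
Proof.
rewrite big_mkord; under eq_bigr => j _.
  rewrite binomial_pmfE (_ : t * j%:R / m%:R = j%:R * (t / m%:R)); last by ring.
  over.
rewrite abel_identity big_mkord; apply: eq_bigr => N _.
by rewrite expr_div_n mulrCA mulrC.
Qed.

Lemma geometric_small (R : realType) (g e : R) : 0 <= g < 1 -> 0 < e ->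
  \forall n \near \oo, g ^+ n <= e.
Proof.
move=> /andP[g0 g1] e0.
have /cvgrPdist_le/(_ _ e0) : g ^+ n @[n --> \oo] --> (0 : R).
  by apply: cvg_expr; rewrite ger0_norm.
apply: filterS => n; rewrite sub0r normrN ger0_norm // exprn_ge0 //.
Qed.

Lemma sum_geometric_le (R : realType) (g : R) (J K : nat) : 0 <= g < 1 ->
  \sum_(J <= j < K) g ^+ j <= g ^+ J / (1 - g).
Proof.
move=> /andP[g0 g1]; have g1' : 0 < 1 - g by lra.
have [KJ|JK] := leqP K J; first by rewrite big_geq // divr_ge0 ?exprn_ge0 // ltW.
rewrite ler_pdivlMr // big_distrl /=.
rewrite (eq_bigr (fun j => - g ^+ j.+1 - (- g ^+ j))); last first.
  by move=> j _; rewrite exprS; ring.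
rewrite telescope_sumr ?(ltnW JK) // opprK addrC gerBl //.
by rewrite exprn_ge0.
Qed.

Lemma norm_sum_geometric_tail (R : realType) (g : R) (J K : nat) (b : nat -> R) :
  0 <= g < 1 -> (forall j, (j < K)%N -> `|b j| <= g ^+ j) ->
  `|\sum_(J <= j < K) b j| <= g ^+ J / (1 - g).
Proof.
move=> g01 bg; apply: le_trans (sum_geometric_le J K g01).
apply: le_trans (ler_norm_sum _ _ _) _.
rewrite big_nat_cond [leRHS]big_nat_cond; apply: ler_sum => j /andP[/andP[_ jK] _].
exact: bg.
Qed.

(** Dominated convergence for finite sums of different lengths: beyond [J] both of them are
    within the geometric tail. *)
Lemma tannery_partial_sums (R : realType) (g eta : R) : 0 <= g < 1 -> 0 < eta ->
  exists J : nat, exists2 eta' : R, 0 < eta' &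
  forall (J1 J2 : nat) (b1 b2 : nat -> R), (J <= J1)%N -> (J <= J2)%N ->
    (forall j, (j < J1)%N -> `|b1 j| <= g ^+ j) ->
    (forall j, (j < J2)%N -> `|b2 j| <= g ^+ j) ->
    (forall j, (j < J)%N -> `|b1 j - b2 j| <= eta') ->
  `|\sum_(0 <= j < J1) b1 j - \sum_(0 <= j < J2) b2 j| <= eta.
Proof.
move=> g01 e0; have /andP[g0 g1] := g01; have g1' : 0 < 1 - g by lra.
have e3 : 0 < eta / 3 * (1 - g) by rewrite mulr_gt0 // divr_gt0.
have [J _ /(_ J (leqnn J)) /= gJ] := geometric_small g01 e3.
exists J; exists (eta / 3 / J.+1%:R) => [|J1 J2 b1 b2 JJ1 JJ2 h1 h2 h12].
  by rewrite !divr_gt0 // ltr0n.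
have hJ : g ^+ J / (1 - g) <= eta / 3 by rewrite ler_pdivrMr.
rewrite (big_cat_nat (leq0n J) JJ1) (big_cat_nat (leq0n J) JJ2) /=.
have := norm_sum_geometric_tail J g01 h1; have := norm_sum_geometric_tail J g01 h2.
have : `|\sum_(0 <= i < J) b1 i - \sum_(0 <= i < J) b2 i| <= eta / 3.
  rewrite -sumrB; apply: le_trans (ler_norm_sum _ _ _) _.
  apply: (@le_trans _ _ (\sum_(0 <= i < J) eta / 3 / J.+1%:R)).
    rewrite big_nat_cond [leRHS]big_nat_cond.
    by apply: ler_sum => j /andP[/andP[_ jJ] _]; exact: h12.
  rewrite sumr_const_nat subn0 -[_ *+ J]mulr_natr mulrAC ler_pdivrMr ?ltr0n //.
  by rewrite ler_wpM2l ?ler_nat ?leqnSn // divr_ge0 // ltW.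
move: (\sum_(0 <= i < J) b1 i) (\sum_(0 <= i < J) b2 i) => s1 s2.
move: (\sum_(J <= i < J1) b1 i) (\sum_(J <= i < J2) b2 i) => t1 t2.
rewrite !ler_norml => /andP[? ?] /andP[? ?] /andP[? ?]; apply/andP; lra.
Qed.

Lemma cvgn_inv_nat (R : realType) : (m%:R^-1 : R) @[m --> \oo] --> (0 : R).
Proof.
apply/gtr0_cvgV0; last exact: cvgr_idn.
by near=> m; rewrite ltr0n; near: m; exists 1%N.
Unshelve. all: by end_near. Qed.

Lemma cvgn_subn_ratio (R : realType) (j : nat) :
  ((m - j)%:R / m%:R : R) @[m --> \oo] --> (1 : R).
Proof.
have : 1 - j%:R * (m%:R^-1 : R) @[m --> \oo] --> 1 - j%:R * (0 : R).
  apply: cvgB; first exact: cvg_cst.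
  by apply: cvgM; [exact: cvg_cst|exact: cvgn_inv_nat].
rewrite mulr0 subr0; move=> H; apply: cvg_trans H; apply: near_eq_cvg; near=> m.
have m0 : (0 < m)%N by near: m; exists 1%N.
rewrite natrB; last by near: m; exists j.
by rewrite mulrBl divff // pnatr_eq0 -lt0n.
Unshelve. all: by end_near. Qed.

Lemma cvgn_ffact_ratio (R : realType) (j : nat) :
  ((m ^_ j)%:R / m%:R ^+ j : R) @[m --> \oo] --> (1 : R).
Proof.
elim: j => [|j IH].
  by apply: cvg_near_cst; near=> m; rewrite ffactn0 expr0 divr1.
have H : ((m ^_ j)%:R / m%:R ^+ j) * ((m - j)%:R / m%:R) @[m --> \oo] --> (1 * 1 : R).
  by apply: cvgM => //; exact: cvgn_subn_ratio.
rewrite mulr1 in H; apply: cvg_trans H; apply: near_eq_cvg.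
by near=> m; rewrite /= ffactnSr natrM exprSr invfM mulrACA.
Unshelve. all: by end_near. Qed.

(** The Poisson limit, with the parameter converging along with the number of trials: the
    success probabilities met later are only asymptotically proportional to [1/m]. *)
Lemma cvg_binomial_pmf_poisson (R : realType) (j : nat) (b0 : R) :
  binomial_pmf p.1 (p.2 * j%:R / p.1%:R) j
    @[p --> filter_prod \oo (nbhs b0)] -->
  (b0 * j%:R) ^+ j / j`!%:R * expR (- (b0 * j%:R)).
Proof.
pose F := filter_prod \oo (nbhs b0).
have cfst (u : nat -> R) (l : R) : u m @[m --> \oo] --> l ->
    u p.1 @[p --> F] --> l.
  by move=> ul; apply: cvg_comp ul; exact: cvg_fst.
have csnd : p.2 * j%:R @[p --> F] --> (b0 * j%:R : R).
  by apply: cvgM; [exact: cvg_snd|exact: cvg_cst].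
have cu : p.2 * j%:R / p.1%:R @[p --> F] --> (0 : R).
  rewrite -(mulr0 (b0 * j%:R)); apply: cvgM => //.
  by apply: (cfst (fun m : nat => m%:R^-1)); exact: cvgn_inv_nat.
have cNu : p.2 * j%:R * ((p.1 - j)%:R / p.1%:R) @[p --> F] --> (b0 * j%:R : R).
  rewrite -[X in _ --> X]mulr1; apply: cvgM => //.
  by apply: (cfst (fun m : nat => (m - j)%:R / m%:R)); exact: cvgn_subn_ratio.
have c1u : 1 - p.2 * j%:R / p.1%:R @[p --> F] --> (1 : R).
  by rewrite -[X in _ --> X]subr0; apply: cvgB => //; exact: cvg_cst.
have cN : (1 - p.2 * j%:R / p.1%:R) ^+ (p.1 - j) @[p --> F] --> expR (- (b0 * j%:R)).
  apply: (@squeeze_cvgr _ _ _ _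
    (fun p => expR (- (p.2 * j%:R * ((p.1 - j)%:R / p.1%:R) / (1 - p.2 * j%:R / p.1%:R))))
    (fun p => expR (- (p.2 * j%:R * ((p.1 - j)%:R / p.1%:R))))).
  - near=> p.
    have u1 : 0 < 1 - p.2 * j%:R / p.1%:R.
      by near: p; apply: (cvgr_gt 1) => //; exact: ltr01.
    set u := p.2 * j%:R / p.1%:R in u1 *.
    rewrite (_ : p.2 * j%:R * _ = (p.1 - j)%:R * u); last by rewrite /u; ring.
    set N := (p.1 - j)%N.
    rewrite (_ : - (N%:R * u / (1 - u)) = N%:R * - (u / (1 - u))); last by ring.
    rewrite -[- (N%:R * u)]mulrN !expRM_natl; apply/andP; split.
    + apply: lerXn2r; rewrite ?nnegrE ?expR_ge0 ?(ltW u1) //.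
      rewrite expRN invf_ple ?posrE ?expR_gt0 //.
      apply: le_trans (expR_ge1Dx _); rewrite le_eqVlt; apply/orP; left; apply/eqP.
      by move: u1; move: u => u u1; field; lra.
    + apply: lerXn2r; rewrite ?nnegrE ?expR_ge0 ?(ltW u1) //.
      exact: expR_ge1Dx.
  - apply: (@continuous_cvg _ _ _ _ _ _ (@expR R)); first exact: continuous_expR.
    apply: cvgN; rewrite -[X in _ --> X]divr1; apply: cvgM => //.
    by apply: cvgV => //; rewrite oner_eq0.
  - apply: (@continuous_cvg _ _ _ _ _ _ (@expR R)); first exact: continuous_expR.
    exact: cvgN.
have cX : (p.2 * j%:R) ^+ j @[p --> F] --> (b0 * j%:R : R) ^+ j.
  by apply: (@continuous_cvg _ _ _ _ _ _ (fun y : R => y ^+ j)) => //; exact: exprn_continuous.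
have cj : (fun=> j`!%:R^-1 : R) @ F --> (j`!%:R^-1 : R) by exact: cvg_cst.
have H : ((p.1 ^_ j)%:R / p.1%:R ^+ j) * ((p.2 * j%:R) ^+ j / j`!%:R) *
    (1 - p.2 * j%:R / p.1%:R) ^+ (p.1 - j) @[p --> F] -->
    1 * ((b0 * j%:R) ^+ j / j`!%:R) * expR (- (b0 * j%:R)).
  apply: cvgM => //; apply: cvgM; last exact: cvgM.
  by apply: (cfst (fun m => (m ^_ j)%:R / m%:R ^+ j)); exact: cvgn_ffact_ratio.
rewrite mul1r in H; apply: cvg_trans H; apply: near_eq_cvg.
near=> p; rewrite /= binomial_pmfE expr_div_n -bin_ffact natrM.
have jf : j`!%:R != 0 :> R by rewrite pnatr_eq0 -lt0n fact_gt0.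
move: (j`!%:R) jf ('C(p.1, j)%:R) (_ ^+ (p.1 - j)) ((_ * _) ^+ j) ((p.1%:R ^+ j)^-1)
  => fj fj0 C U V W.
by field.
Unshelve. all: by end_near. Qed.

Lemma near_forall_ltn (T : Type) (F : set_system T) (FF : Filter F)
    (P : nat -> T -> Prop) (J : nat) :
  (forall j, (j < J)%N -> \forall x \near F, P j x) ->
  \forall x \near F, forall j, (j < J)%N -> P j x.
Proof.
elim: J => [|J IH] H; first by near=> x => j.
have H1 : \forall x \near F, forall j, (j < J)%N -> P j x.
  by apply: IH => j jJ; apply: H; rewrite ltnS ltnW.
have H2 := H J (ltnSn J).
near=> x => j; rewrite ltnS leq_eqVlt => /orP[/eqP ->|].
  by near: x.
by move: j; near: x.
Unshelve. all: by end_near. Qed.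

Lemma ffact_le_expn (m j : nat) : (m ^_ j <= m ^ j)%N.
Proof.
by elim: j => // j IH; rewrite ffactnSr expnSr leq_mul // leq_subr.
Qed.

Lemma ffact_ratio_le1 (R : realType) (m j : nat) : (0 < m)%N ->
  0 <= ((m ^_ j)%:R / m%:R ^+ j : R) <= 1.
Proof.
move=> m0; have mj : (0 : R) < m%:R ^+ j by rewrite exprn_gt0 // ltr0n.
rewrite divr_ge0 ?(ltW mj) //= ler_pdivrMr // mul1r -natrX ler_nat.
exact: ffact_le_expn.
Qed.

(** The right-hand side of Abel's identity at [z = t/m] tends to the geometric series. *)
Lemma sum_ffact_geometric (R : realType) (t eta : R) : 0 <= t < 1 -> 0 < eta ->
  \forall m \near \oo,
    `|\sum_(0 <= N < m.+1) (m ^_ N)%:R / m%:R ^+ N * t ^+ N - (1 - t)^-1| <= eta.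
Proof.
move=> t01 e0; have /andP[t0 t1] := t01; have t1' : 0 < 1 - t by lra.
have e2 : 0 < eta / 2 by lra.
have e3 : 0 < eta / 2 * (1 - t) by rewrite mulr_gt0.
have [J [e' e'0 H]] := tannery_partial_sums t01 e2.
have near1 : \forall m \near \oo, forall j, (j < J)%N ->
    `|1 - (m ^_ j)%:R / m%:R ^+ j| <= e' :> R.
  by apply: near_forall_ltn => j _; move: (@cvgn_ffact_ratio R j) => /cvgrPdist_le; exact.
near=> m.
have m0 : (0 < m)%N by near: m; exists 1%N.
have Jm : (J <= m.+1)%N by apply: leqW; near: m; exists J.
have := H m.+1 m.+1 (fun N => (m ^_ N)%:R / m%:R ^+ N * t ^+ N) (fun N => t ^+ N) Jm Jm.
have tj j : 0 <= t ^+ j by rewrite exprn_ge0.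
have A j : (j < m.+1)%N -> `|(m ^_ j)%:R / m%:R ^+ j * t ^+ j| <= t ^+ j.
  move=> _; have /andP[r0 r1] := ffact_ratio_le1 R j m0.
  by rewrite normrM !ger0_norm // ler_piMl.
have B j : (j < m.+1)%N -> `|t ^+ j| <= t ^+ j by move=> _; rewrite ger0_norm.
have C j : (j < J)%N -> `|(m ^_ j)%:R / m%:R ^+ j * t ^+ j - t ^+ j| <= e'.
  move=> jJ; rewrite -{2}[t ^+ j]mul1r -mulrBl normrM (ger0_norm (tj j)) distrC.
  apply: (@le_trans _ _ (e' * 1)); last by rewrite mulr1.
  apply: ler_pM => //; last by rewrite exprn_ile1 // ltW.
  by move: j jJ; near: m.
move=> /(_ A B C).
have : `|\sum_(0 <= j < m.+1) t ^+ j - (1 - t)^-1| <= eta / 2.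
  rewrite (_ : _ - _ = - (t ^+ m.+1 / (1 - t))).
    rewrite normrN ger0_norm ?divr_ge0 ?(ltW t1') // ler_pdivrMr //.
    apply: (@le_trans _ _ (t ^+ m)); first by rewrite exprS ler_piMl // ltW.
    by near: m; exact: (geometric_small t01 e3).
  have E : (1 - t) * \sum_(0 <= j < m.+1) t ^+ j = 1 - t ^+ m.+1.
    by have := subrX1 t m.+1; rewrite big_mkord => H1; rewrite -[LHS]opprK -mulNr opprB -H1 opprB.
  by apply: (mulfI (lt0r_neq0 t1')); rewrite mulrBr E; field; lra.
set S1 := \sum_(0 <= N < m.+1) _; set S2 := \sum_(0 <= N < m.+1) _.
by rewrite !ler_norml => /andP[? ?] /andP[? ?]; apply/andP; lra.
Unshelve. all: by end_near. Qed.

Lemma cvg_xexpN (R : realType) (a : R) :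
  b * expR (1 - b) @[b --> a] --> a * expR (1 - a).
Proof.
apply: cvgM; first exact: cvg_id.
apply: (@continuous_cvg _ _ _ _ _ _ (@expR R)); first exact: continuous_expR.
by apply: cvgB; [exact: cvg_cst|exact: cvg_id].
Qed.

(** The ratio of the dominating geometric sequence is below 1 away from [a = 1]. *)
Lemma xexpN_lt1 (R : realType) (a : R) : a != 1 -> a * expR (1 - a) < 1.
Proof.
move=> a1; have := @expR_gt1Dx R (a - 1); rewrite subr_eq0 => /(_ a1).
rewrite addrC subrK -opprB expRN => h.
by rewrite -ltr_pdivlMr ?expR_gt0 // mul1r.
Qed.

(** The expected number of visits to 0 of the walk with Poisson steps of mean [alpha > 1]
    minus 1 is [1/(1 - theta)]. The sum is compared with the one at the conjugate parameter
    [theta]: the terms have the same Poisson limits, as these are functions of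
    [alpha exp(-alpha)], and the same geometric bound. The family [beta] absorbs the
    variation of the slope over the window. *)
Lemma sum_returns_supercritical (R : realType) (alpha theta eta : R) :
  1 < alpha -> 0 < theta < 1 ->
  theta * expR (- theta) = alpha * expR (- alpha) -> 0 < eta ->
  exists2 delta : R, 0 < delta & \forall M \near \oo,
  forall (m K : nat) (beta : nat -> R), (M <= K)%N -> (K <= m.+1)%N ->
    (forall j, (j < K)%N -> `|alpha - beta j| <= delta) ->
    (forall j, (j < K)%N -> beta j * j%:R <= m%:R) ->
  `|\sum_(0 <= j < K) binomial_pmf m (beta j * j%:R / m%:R) j - (1 - theta)^-1|
    <= eta.
Proof.
move=> a1 /andP[t0 t1] tE e0.
have tE' : theta * expR (1 - theta) = alpha * expR (1 - alpha).
  by rewrite !expRD !(mulrCA _ (expR 1)) tE.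
have ga : alpha * expR (1 - alpha) < 1 by apply: xexpN_lt1; rewrite gt_eqF.
(* Any ratio strictly between alpha exp(1 - alpha) and 1 dominates both sums. *)
pose g := (1 + alpha * expR (1 - alpha)) / 2.
have ga0 : 0 <= alpha * expR (1 - alpha) by rewrite mulr_ge0 ?expR_ge0 //; lra.
have g01 : 0 <= g < 1 by rewrite /g; lra.
have e2 : 0 < eta / 2 by lra.
have [J [e' e'0 H]] := tannery_partial_sums g01 e2.
have e'2 : 0 < e' / 2 by lra.
pose u (b : R) j := (b * j%:R) ^+ j / j`!%:R * expR (- (b * j%:R)).
have uE j : u theta j = u alpha j.
  rewrite /u !exprMn -!mulNr ![- _ * _]mulrC !expRM_natl.
  transitivity ((theta * expR (- theta)) ^+ j * (j%:R ^+ j / j`!%:R)).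
    by rewrite exprMn; ring.
  by rewrite tE exprMn; ring.
have near_alpha : \forall b \near alpha, 0 <= b /\ b * expR (1 - b) <= g.
  near=> b; split; near: b.
    by apply: (cvgr_ge alpha); [exact: cvg_id|lra].
  by apply: (cvgr_le (alpha * expR (1 - alpha))); [exact: cvg_xexpN|rewrite /g; lra].
have P b : \forall p \near filter_prod \oo (nbhs b), forall j, (j < J)%N ->
    `|u b j - binomial_pmf p.1 (p.2 * j%:R / p.1%:R) j| <= e' / 2.
  apply: near_forall_ltn => j _.
  by have /cvgrPdist_le := @cvg_binomial_pmf_poisson R j b; exact.
have norm_le m b j : (0 < m)%N -> (j < m.+1)%N -> 0 <= b -> b * expR (1 - b) <= g ->
    b * j%:R <= m%:R -> `|binomial_pmf m (b * j%:R / m%:R) j| <= g ^+ j.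
  move=> m0 jm b0 bg bjm; have mR : (0 : R) < m%:R by rewrite ltr0n.
  rewrite ger0_norm; last first.
    by rewrite binomial_pmf_ge0 // ler_pdivrMr // mul1r bjm divr_ge0 // ?mulr_ge0.
  apply: le_trans (binomial_pmf_le_geo m0 jm b0 bjm) _.
  by apply: lerXn2r; rewrite ?nnegrE ?mulr_ge0 ?expR_ge0 //; lra.
(* The reference sum at theta: close to its limit, with terms close to the Poisson ones. *)
have [m2 [Jm2 [m20 [m2P m2S]]]] : exists m2, (J <= m2)%N /\ (0 < m2)%N /\
    (forall j, (j < J)%N ->
      `|u theta j - binomial_pmf m2 (theta * j%:R / m2%:R) j| <= e' / 2) /\
    `|\sum_(0 <= j < m2.+1) binomial_pmf m2 (theta * j%:R / m2%:R) j - (1 - theta)^-1|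
      <= eta / 2.
  have [[A B] [/= nA nB] AB] := P theta.
  have nS := @sum_ffact_geometric R theta (eta / 2).
  have {}nS := nS _ e2.
  near \oo => m2; exists m2; split; first by near: m2; exists J.
  split; first by near: m2; exists 1%N.
  split.
    move=> j jJ; apply: (AB (m2, theta)) => //; split => /=; first by near: m2.
    exact: nbhs_singleton.
  rewrite sum_binomial_pmf_abel; near: m2; apply: nS; lra.
have [[A B] [/= [N _ NA] nB] AB] := P alpha.
have [d /= d0 dB] : nbhs_ball alpha (B `&` [set b | 0 <= b /\ b * expR (1 - b) <= g]).
  by apply/nbhs_ballP; exact: filterI.
exists (d / 2); first by lra.
near=> M => m K beta MK Km bd bm.
have Mm : (M <= m.+1)%N by apply: leq_trans Km.
have inB j : (j < K)%N -> B (beta j) /\ (0 <= beta j /\ beta j * expR (1 - beta j) <= g).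
  by move=> jK; apply: dB; apply: le_lt_trans (bd _ jK) _; lra.
have m0 : (0 < m)%N by rewrite -ltnS; apply: leq_trans Mm; near: M; exists 2%N.
have JM : (J <= M)%N by near: M; exists J.
have Am : A m.
  by apply: NA => /=; rewrite -ltnS; apply: leq_trans Mm; near: M; exists N.+1.
have := H K m2.+1 (fun j => binomial_pmf m (beta j * j%:R / m%:R) j)
  (fun j => binomial_pmf m2 (theta * j%:R / m2%:R) j) (leq_trans JM MK) (leqW Jm2).
have h1 j : (j < K)%N -> `|binomial_pmf m (beta j * j%:R / m%:R) j| <= g ^+ j.
  move=> jK; have [_ [? ?]] := inB _ jK.
  by apply: norm_le => //; [exact: leq_trans Km|exact: bm].
have h2 j : (j < m2.+1)%N -> `|binomial_pmf m2 (theta * j%:R / m2%:R) j| <= g ^+ j.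
  move=> jm; apply: norm_le => //; first exact: ltW.
    by rewrite tE' /g; lra.
  by rewrite (@le_trans _ _ j%:R) ?ler_nat // ler_piMl // ltW.
have h3 j : (j < J)%N -> `|binomial_pmf m (beta j * j%:R / m%:R) j -
    binomial_pmf m2 (theta * j%:R / m2%:R) j| <= e'.
  move=> jJ; have jK : (j < K)%N by apply: leq_trans jJ (leq_trans JM MK).
  have := m2P _ jJ; have := AB (m, beta j) (conj Am (inB _ jK).1) j jJ.
  rewrite uE /= !ler_norml => /andP[k1 k2] /andP[k3 k4]; apply/andP.
  clear - k1 k2 k3 k4; lra.
move=> /(_ h1 h2 h3); move: m2S.
rewrite !ler_norml => /andP[k1 k2] /andP[k3 k4]; apply/andP.
clear - k1 k2 k3 k4; lra.
Unshelve. all: by end_near. Qed.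

(** * The rate of crossing *)

(** Changing the parameter of a binomial from [p] to [q] changes its density at [k] only to
    second order when [p] and [q] are both close to [k/n]. *)
Lemma binomial_odds_le (R : realType) (n k : nat) (p q : R) :
  0 < p < 1 -> 0 < q < 1 -> (k <= n)%N ->
  (q / p) ^+ k * ((1 - q) / (1 - p)) ^+ (n - k) <=
    expR ((q - p) * (k%:R - n%:R * p) / (p * (1 - p))).
Proof.
move=> /andP[p0 p1] /andP[q0 q1] kn.
have p1' : 0 < 1 - p by lra.
rewrite (_ : (q - p) * (k%:R - n%:R * p) / (p * (1 - p)) =
  k%:R * ((q - p) / p) + (n - k)%:R * (- ((q - p) / (1 - p)))); last first.
  by rewrite natrB //; field; lra.
rewrite expRD !expRM_natl; apply: ler_pM; rewrite ?exprn_ge0 ?divr_ge0 //; try lra.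
  apply: lerXn2r; rewrite ?nnegrE ?expR_ge0 ?divr_ge0 //; try lra.
  apply: le_trans (expR_ge1Dx _); rewrite le_eqVlt; apply/orP; left; apply/eqP.
  by field; lra.
apply: lerXn2r; rewrite ?nnegrE ?expR_ge0 ?divr_ge0 //; try lra.
apply: le_trans (expR_ge1Dx _); rewrite le_eqVlt; apply/orP; left; apply/eqP.
by field; lra.
Qed.

Lemma binomial_pmf_succ (R : realType) (n k : nat) (p : R) :
  p < 1 -> (k < n)%N ->
  binomial_pmf n p k.+1 =
    binomial_pmf n p k * ((n%:R - k%:R) / k.+1%:R * (p / (1 - p))).
Proof.
move=> p1 kn; have p1' : 1 - p != 0 by rewrite gt_eqF //; lra.
have k1 : k.+1%:R != 0 :> R by rewrite pnatr_eq0.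
have H : k.+1%:R * 'C(n, k.+1)%:R = (n%:R - k%:R) * 'C(n, k)%:R :> R.
  by rewrite -natrB 1?ltnW // -!natrM mul_bin_left.
rewrite !binomial_pmfE subnS exprS -[in RHS](prednK (_ : 0 < n - k)%N) ?subn_gt0 //.
rewrite [(1 - p) ^+ _.+1]exprS; apply: (mulfI k1).
rewrite [LHS]mulrA H; move: (p ^+ k) ((1 - p) ^+ _) ('C(n, k)%:R) (n%:R) k1 p1'
  => A B C N k1 p1'.
move: (k.+1%:R) k1 => K k1; by field; apply/andP; split.
Qed.

Lemma binomial_pmf_pred_trials (R : realType) (n k : nat) (p q : R) :
  0 < p < 1 -> q < 1 -> (k.+1 <= n)%N ->
  n.+1%:R * binomial_pmf n q k.+1 =
    binomial_pmf n.+1 p k *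
    ((n.+1%:R - k%:R) * (n%:R - k%:R) / k.+1%:R * (q / (1 - q) ^+ 2) *
     ((q / p) ^+ k * ((1 - q) / (1 - p)) ^+ (n.+1 - k))).
Proof.
move=> /andP[p0 p1] q1 kn.
have q1' : 1 - q != 0 by rewrite gt_eqF //; lra.
have p1' : 1 - p != 0 by rewrite gt_eqF //; lra.
have k1 : k.+1%:R != 0 :> R by rewrite pnatr_eq0.
have H : k.+1%:R * (n.+1%:R * 'C(n, k.+1)%:R) =
    (n.+1%:R - k%:R) * (n%:R - k%:R) * 'C(n.+1, k)%:R :> R.
  have kn1 : (k <= n.+1)%N by lia.
  rewrite -!natrB // 1?ltnW // -!natrM; congr (_%:R).
  have := mul_bin_left n k; have := mul_bin_down n.+1 k => /=.
  by move=> e1 e2; rewrite [LHS]mulnCA e2 [LHS]mulnCA e1 [LHS]mulnCA mulnA.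
rewrite !binomial_pmfE !expr_div_n exprS.
rewrite -[(n.+1 - k)%N](prednK (_ : 0 < n.+1 - k)%N) ?subn_gt0 1?ltnW //.
rewrite -[(n.+1 - k).-1](prednK (_ : 0 < (n.+1 - k).-1)%N); last by lia.
have -> : ((n.+1 - k).-1.-1 = n - k.+1)%N by lia.
have pk : p ^+ k != 0 by rewrite expf_neq0 // gt_eqF.
have pnk : (1 - p) ^+ (n - k.+1) != 0 by rewrite expf_neq0.
have assoc4 (a b c d : R) : a * (b * (c * d)) = (a * (b * c)) * d by ring.
apply: (mulfI k1); rewrite [LHS]assoc4 H.
rewrite ![_ ^+ _.+2]exprS ![_ ^+ (n - k.+1).+1]exprS.
move: (p ^+ k) pk (q ^+ k) ((1 - p) ^+ (n - k.+1)) pnk ((1 - q) ^+ (n - k.+1)) => A pk B C pnk D.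
move: ('C(n.+1, k)%:R) (n.+1%:R) (n%:R) (k%:R) (k.+1%:R) k1 => F N N' K K1 k1.
by field; rewrite q1' p1' k1 pk pnk.
Qed.

(** The jump of [P(G(k) > k)] relative to [P(G(k) = k)]: the first term of the bracket is the
    effect of the larger parameter, the second one that of the higher level. *)
Lemma binomial_tail_step (R : realType) (n k : nat) (p q : R) :
  0 < p -> p <= q -> q < 1 -> (k.+1 <= n)%N ->
  exists2 xi, p <= xi <= q &
  binomial_tail n.+1 q k.+2 - binomial_tail n.+1 p k.+1 =
  binomial_pmf n.+1 p k *
   ((q - p) * ((n.+1%:R - k%:R) * (n%:R - k%:R) / k.+1%:R * (xi / (1 - xi) ^+ 2) *
     ((xi / p) ^+ k * ((1 - xi) / (1 - p)) ^+ (n.+1 - k)))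
     - (n.+1%:R - k%:R) / k.+1%:R * (p / (1 - p))).
Proof.
move=> p0 pq q1 kn; have [xi /andP[pxi xiq] E] := binomial_tail_MVT kn pq.
exists xi; first by rewrite pxi.
have -> : binomial_tail n.+1 p k.+1 = binomial_pmf n.+1 p k.+1 + binomial_tail n.+1 p k.+2.
  by rewrite /binomial_tail big_ltn // ltnS leqW.
have pp : 0 < p < 1 by lra.
rewrite opprD addrCA E (binomial_pmf_pred_trials pp) //; last by lra.
rewrite binomial_pmf_succ ?(leqW kn) //; last by lra.
rewrite [RHS]mulrBr [LHS]addrC; congr (_ - _).
by rewrite -[LHS]mulrA; congr (_ * _); rewrite mulrC.
Qed.

(** The filter of pairs [(n, k)] with [n] tending to infinity and [k/n] to [x]. Statements
    near it are uniform over the indices [k] of a small window around [n x]. *)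
Definition window (R : realType) (x : R) : set_system (nat * nat) :=
  [set A | exists N : nat, exists2 d : R, 0 < d &
    forall n k : nat, (N <= n)%N -> `|x - k%:R / n%:R| < d -> A (n, k)].

Global Instance window_filter (R : realType) (x : R) : Filter (window x).
Proof.
split.
- by exists 0%N, 1.
- move=> A B [N [d d0 hA]] [M [e e0 hB]].
  exists (maxn N M), (Num.min d e) => [|n k]; first by rewrite lt_min d0.
  rewrite geq_max lt_min => /andP[Nn Mn] /andP[kd ke].
  by split; [exact: hA|exact: hB].
- move=> A B AB [N [d d0 hA]]; exists N, d => // n k Nn kd.
  by apply: AB; exact: hA.
Qed.

Lemma cvg_window_frac (R : realType) (x : R) :
  (p.2%:R / p.1%:R : R) @[p --> window x] --> x.
Proof.
apply/cvgrPdist_lt => e e0; by exists 0%N, e.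
Qed.

Lemma cvg_window_fst (R : realType) (x : R) : fst @ window x --> \oo.
Proof. by move=> A [N _ NA]; exists N, 1 => // n k Nn _; exact: NA. Qed.

Lemma cvg_window_inv (R : realType) (x : R) :
  (p.1%:R^-1 : R) @[p --> window x] --> (0 : R).
Proof.
apply: (@cvg_comp _ _ _ fst (fun m : nat => m%:R^-1 : R) _ \oo).
  exact: cvg_window_fst.
exact: cvgn_inv_nat.
Qed.

(** Strict differentiability of [pi] at [x], stated with difference quotients. *)
Definition strict_slope (R : realType) (pi : R -> R) (x a : R) :=
  forall e, 0 < e -> exists2 d, 0 < d & forall y z, `|x - y| < d -> `|x - z| < d ->
    y <= z -> (a - e) * (z - y) <= pi z - pi y <= (a + e) * (z - y).

Lemma strict_slope_cvg (R : realType) (pi : R -> R) (x a : R) :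
  0 < a -> strict_slope pi x a -> pi y @[y --> x] --> pi x.
Proof.
move=> a0 ss; have [d d0 H] := ss _ a0.
apply/cvgrPdist_le => e e0; near=> y.
have yd : `|x - y| < d by near: y; apply/nbhs_ballP; exists d.
have ye : `|x - y| <= e / (2 * a).
  near: y; apply/nbhs_ballP; exists (e / (2 * a)) => [|y /ltW //] /=.
  by rewrite divr_gt0 //; lra.
have xd : `|x - x| < d by rewrite subrr normr0.
have := ler_norm (x - y); have := ler_norm (- (x - y)); rewrite normrN => n1 n2.
have ae : (2 * a) * `|x - y| <= e by rewrite mulrC -ler_pdivlMr //; lra.
have [xy|yx] := leP x y.
  have /andP[h1 h2] := H _ _ xd yd xy; rewrite ler_norml; apply/andP.
  by clear - h1 h2 ae n1 n2 xy a0; split; nra.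
have /andP[h1 h2] := H _ _ yd xd (ltW yx); rewrite ler_norml; apply/andP.
by clear - h1 h2 ae n1 n2 yx a0; split; nra.
Unshelve. all: by end_near. Qed.

(** In the notation of [binomial_tail_step], along the window filter [n (q - p)] tends to [a],
    while [p], [q], [xi] and [k/n] tend to [x]; hence the bracket tends to [a - 1]. *)
Lemma crossing_rate (R : realType) (pi : R -> R) (x a eta : R) :
  0 < x < 1 -> pi x = x -> 0 < a -> strict_slope pi x a -> 0 < eta ->
  \forall p \near window x,
    `|binomial_tail p.1 (pi (p.2.+1%:R / p.1%:R)) p.2.+2
      - binomial_tail p.1 (pi (p.2%:R / p.1%:R)) p.2.+1
      - (a - 1) * binomial_pmf p.1 (pi (p.2%:R / p.1%:R)) p.2|
    <= eta * binomial_pmf p.1 (pi (p.2%:R / p.1%:R)) p.2.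
Proof.
move=> /andP[x0 x1] pix a0 ss eta0.
pose v (p : nat * nat) : R := p.1%:R^-1.
pose s (p : nat * nat) : R := p.2%:R / p.1%:R.
pose s' (p : nat * nat) : R := p.2.+1%:R / p.1%:R.
pose P p := pi (s p); pose P' p := pi (s' p).
have cv : v p @[p --> window x] --> (0 : R) by exact: cvg_window_inv.
have cs : s p @[p --> window x] --> x by exact: cvg_window_frac.
have s'E p : s' p = s p + v p by rewrite /s' /s /v -[p.2.+1]addn1 natrD mulrDl mul1r.
have csv : s p + v p @[p --> window x] --> x.
  by rewrite -[X in _ --> X]addr0; exact: cvgD.
have cs' : s' p @[p --> window x] --> x.
  by rewrite (_ : s' = fun p => s p + v p) //; apply/funext.
have pic : pi y @[y --> x] --> x by rewrite -{2}pix; exact: strict_slope_cvg ss.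
have cP : P p @[p --> window x] --> x by exact: (cvg_comp _ _ cs pic).
have cP' : P' p @[p --> window x] --> x by exact: (cvg_comp _ _ cs' pic).
have n0 : \forall p \near window x, (0 < p.1)%N.
  by apply: (@cvg_window_fst R x [set n | (0 < n)%N]); exists 1%N.
pose A p := p.1%:R * (P' p - P p).
have cA : A p @[p --> window x] --> a.
  apply/cvgrPdist_le => e e0; have [d d0 H] := ss _ e0.
  near=> p.
  have sd : `|x - s p| < d by near: p; exact: (cvgr_dist_lt _ _ cs).
  have sd' : `|x - s' p| < d by near: p; exact: (cvgr_dist_lt _ _ cs').
  have p0 : (0 : R) < p.1%:R by rewrite ltr0n; near: p.
  have ss' : s p <= s' p by rewrite s'E lerDl invr_ge0 ltW.
  have := H _ _ sd sd' ss'; rewrite s'E addrAC subrr add0r -s'E -/(P p) -/(P' p).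
  rewrite /v ler_pdivrMr // ler_pdivlMr // [_ * p.1%:R]mulrC -/(A p) => /andP[? ?].
  by rewrite ler_norml; apply/andP; lra.
(* The statement of binomial_tail_step with k = n s and 1/n = v. *)
pose xi_spec p (xi : R) := P p <= xi <= P' p /\
  binomial_tail p.1 (P' p) p.2.+2 - binomial_tail p.1 (P p) p.2.+1 =
  binomial_pmf p.1 (P p) p.2 *
   (A p * ((1 - s p) * (1 - s p - v p) / (s p + v p) * (xi / (1 - xi) ^+ 2) *
     ((xi / P p) ^+ p.2 * ((1 - xi) / (1 - P p)) ^+ (p.1 - p.2)))
     - (1 - s p) / (s p + v p) * (P p / (1 - P p))).
have xi_near : \forall p \near window x, (p.2 < p.1)%N /\ exists xi, xi_spec p xi.
  near=> p.
  have p0 : (0 < p.1)%N by near: p.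
  have pR : (0 : R) < p.1%:R by rewrite ltr0n.
  have P0 : 0 < P p by near: p; exact: (cvgr_gt x).
  have P'1 : P' p < 1 by near: p; exact: (cvgr_lt x).
  have A0 : 0 < A p by near: p; exact: (cvgr_gt a).
  have PP' : P p <= P' p.
    by move: A0; rewrite /A pmulr_rgt0 // subr_gt0 => /ltW.
  have kn : (p.2.+2 <= p.1)%N.
    suff : s p + v p + v p <= 1.
      rewrite /s /v -(ler_pM2r pR) !mulrDl mulfVK ?gt_eqF // mulVf ?gt_eqF // mul1r.
      by rewrite !natr1 ler_nat.
    by near: p; apply: (cvgr_le x) => //; rewrite -[X in _ --> X]addr0; exact: cvgD.
  split; first by lia.
  have s0 : 0 < s p + v p by near: p; exact: (cvgr_gt x).
  case En : p.1 p0 => [//|n] _.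
  have kn' : (p.2.+1 <= n)%N by rewrite -ltnS -En.
  have [xi Pxi E] := binomial_tail_step P0 PP' P'1 kn'.
  exists xi; split => //; rewrite En E.
  have nR : n.+1%:R != 0 :> R by rewrite pnatr_eq0.
  have kR : p.2.+1%:R != 0 :> R by rewrite pnatr_eq0.
  have e1 : 1 - s p = (n.+1%:R - p.2%:R) / n.+1%:R.
    by rewrite /s En mulrBl divff.
  have e2 : s p + v p = p.2.+1%:R / n.+1%:R.
    by rewrite -s'E /s' En.
  have e3 : 1 - s p - v p = (n%:R - p.2%:R) / n.+1%:R.
    by rewrite e1 /v En -[n.+1%:R]natr1; field; rewrite natr1.
  have e4 : P' p - P p = A p / n.+1%:R by rewrite /A En mulrC mulKf.
  rewrite e3 e1 e2 e4.
  move: (xi / (1 - xi) ^+ 2) (P p / (1 - P p)) (_ ^+ p.2 * _) (A p) (binomial_pmf _ _ _)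
    (n%:R - p.2%:R) (n.+1%:R - p.2%:R) => X Y Z V B C D.
  move: (p.2.+1%:R) kR (n.+1%:R) nR => K kR N nR.
  by field; rewrite kR nR.
have /choice[xi xiP] : forall p, exists y, (exists y, xi_spec p y) -> xi_spec p y.
  move=> p.
  have [[y Hy]|n] := pselect (exists y, xi_spec p y); first by exists y.
  by exists 0.
have {}xiP : \forall p \near window x, (p.2 < p.1)%N /\ xi_spec p (xi p).
  by apply: filterS xi_near => p [kn /xiP].
have cxi : xi p @[p --> window x] --> x.
  by apply: squeeze_cvgr cP cP'; apply: filterS xiP => p [_ []].
pose E p := (xi p / P p) ^+ p.2 * ((1 - xi p) / (1 - P p)) ^+ (p.1 - p.2).
have small w : w p @[p --> window x] --> x ->
    A p * `|s p - w p| / (w p * (1 - w p)) @[p --> window x] --> (0 : R).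
  move=> cw.
  have -> : 0 = a * `|x - x| / (x * (1 - x)) by rewrite subrr normr0 mulr0 mul0r.
  apply: cvgM; first by apply: cvgM => //; apply: cvg_norm; exact: cvgB.
  apply: cvgV; first by rewrite gt_eqF // mulr_gt0 //; lra.
  by apply: cvgM => //; apply: cvgB => //; exact: cvg_cst.
have cexp w : w p @[p --> window x] --> (0 : R) ->
    expR (w p) @[p --> window x] --> (1 : R).
  by rewrite -expR0; apply: continuous_cvg; exact: continuous_expR.
have cE : E p @[p --> window x] --> (1 : R).
  apply: (@squeeze_cvgr _ _ _ _
    (fun p => expR (- (A p * `|s p - xi p| / (xi p * (1 - xi p)))))
    (fun p => expR (A p * `|s p - P p| / (P p * (1 - P p))))).
  - near=> p.
    have p0 : (0 < p.1)%N by near: p.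
    have pR : (0 : R) < p.1%:R by rewrite ltr0n.
    have [kn [/andP[Pxi xiP'] _]] : (p.2 < p.1)%N /\ xi_spec p (xi p) by near: p.
    have P01 : 0 < P p < 1.
      by apply/andP; split; near: p; [exact: (cvgr_gt x)|exact: (cvgr_lt x)].
    have xi01 : 0 < xi p < 1.
      by apply/andP; split; near: p; [exact: (cvgr_gt x)|exact: (cvgr_lt x)].
    have sE : p.2%:R = p.1%:R * s p by rewrite /s mulrCA divff ?mulr1 // gt_eqF.
    have bound y : `|p.1%:R * (xi p - P p) * y| <= A p * `|y|.
      rewrite normrM ler_wpM2r // ger0_norm; last by rewrite mulr_ge0 ?(ltW pR) // subr_ge0.
      by rewrite /A ler_pM2l // lerB.
    apply/andP; split.
    + have : E p * ((P p / xi p) ^+ p.2 * ((1 - P p) / (1 - xi p)) ^+ (p.1 - p.2)) = 1.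
        rewrite /E mulrACA -!exprMn.
        have -> : xi p / P p * (P p / xi p) = 1 by clear - P01 xi01; field; lra.
        have -> : (1 - xi p) / (1 - P p) * ((1 - P p) / (1 - xi p)) = 1.
          by clear - P01 xi01; field; lra.
        by rewrite !expr1n mulr1.
      have := binomial_odds_le xi01 P01 (ltnW kn).
      set E' := (P p / xi p) ^+ p.2 * _ => hE' EE'.
      have E'0 : 0 < E'.
        by rewrite mulr_gt0 // exprn_gt0 // divr_gt0 //; clear - P01 xi01; lra.
      have -> : E p = E'^-1 by apply: (mulIf (lt0r_neq0 E'0)); rewrite EE' mulVf ?gt_eqF.
      rewrite expRN lef_pV2 ?posrE ?expR_gt0 //; apply: le_trans hE' _.
      rewrite ler_expR ler_pM2r ?invr_gt0; last by rewrite mulr_gt0 //; clear - P01 xi01; lra.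
      rewrite sE -mulrBr mulrA [_ * p.1%:R]mulrC -[P p - xi p]opprB mulrN mulNr.
      by apply: le_trans (bound _); rewrite -normrN ler_norm.
    + apply: le_trans (binomial_odds_le P01 xi01 (ltnW kn)) _.
      rewrite ler_expR ler_pM2r ?invr_gt0; last by rewrite mulr_gt0 //; clear - P01 xi01; lra.
      rewrite sE -mulrBr mulrA [_ * p.1%:R]mulrC.
      by apply: le_trans (bound _); exact: ler_norm.
  - by apply: cexp; rewrite -oppr0; apply: cvgN; exact: small.
  - by apply: cexp; exact: small.
pose Phi p := A p * ((1 - s p) * (1 - s p - v p) / (s p + v p) *
  (xi p / (1 - xi p) ^+ 2) * E p) - (1 - s p) / (s p + v p) * (P p / (1 - P p)).
have cPhi : Phi p @[p --> window x] --> a - 1.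
  have -> : a - 1 = a * ((1 - x) * (1 - x - 0) / x * (x / (1 - x) ^+ 2) * 1)
      - (1 - x) / x * (x / (1 - x)) by field; lra.
  have c1 w : w p @[p --> window x] --> x -> 1 - w p @[p --> window x] --> 1 - x.
    by move=> cw; apply: cvgB => //; exact: cvg_cst.
  have x1' : 1 - x != 0 by rewrite gt_eqF //; lra.
  apply: cvgB; last first.
    apply: cvgM; apply: cvgM => //; try exact: c1; apply: cvgV => //; try exact: c1.
    by rewrite gt_eqF.
  apply: cvgM => //; apply: cvgM => //; apply: cvgM.
    apply: cvgM; first by apply: cvgM; [exact: c1|apply: cvgB => //; exact: c1].
    by apply: cvgV => //; rewrite gt_eqF.
  apply: cvgM => //; apply: cvgV; first by rewrite expf_neq0.
  by rewrite !expr2; apply: cvgM; exact: c1.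
have eta_near : \forall p \near window x, `|a - 1 - Phi p| <= eta.
  by move/cvgrPdist_le: cPhi; exact.
near=> p.
have [kn [_ ->]] : (p.2 < p.1)%N /\ xi_spec p (xi p) by near: p.
rewrite -/(E p) -/(Phi p) -/(s p) -/(P p).
have b0 : 0 <= binomial_pmf p.1 (P p) p.2.
  apply: binomial_pmf_ge0; apply/andP; split; near: p.
    exact: (cvgr_ge x).
  exact: (cvgr_le x).
rewrite [_ * Phi p]mulrC -mulrBl normrM (ger0_norm b0) ler_wpM2r // distrC.
by near: p.
Unshelve. all: by end_near. Qed.

(** * Labels with a product distribution *)

Definition product_mass (R : realType) (n M : nat) (w : 'I_M -> R)
    (A : pred {ffun 'I_n -> 'I_M}) : R :=
  \sum_(f | A f) \prod_i w (f i).

Definition count_le (n M : nat) (f : {ffun 'I_n -> 'I_M}) (k : nat) : nat :=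
  (\sum_i (f i <= k))%N.

Definition cum_mass (R : realType) (M : nat) (w : 'I_M -> R) (k : nat) : R :=
  \sum_(j : 'I_M | (j <= k)%N) w j.

(** Forgets the value of a label at most [l] but records that it is at most [l]: what remains
    is the information carried by the counts at levels [l] and above. *)
Definition hide_le (M : nat) (l : nat) (j : 'I_M) : option 'I_M :=
  if (j <= l)%N then None else Some j.

Definition hide_below (n M : nat) (l : nat) (f : {ffun 'I_n -> 'I_M}) :
  {ffun 'I_n -> option 'I_M} := [ffun i => hide_le l (f i)].

Definition count_hidden (n M : nat) (h : {ffun 'I_n -> option 'I_M}) : nat :=
  (\sum_i (h i == None))%N.

Lemma count_hiddenE (n M l : nat) (f : {ffun 'I_n -> 'I_M}) :
  count_hidden (hide_below l f) = count_le f l.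
Proof.
by apply: eq_bigr => i _; rewrite ffunE /hide_le; case: ifP.
Qed.

Lemma cum_mass_hide (R : realType) (M : nat) (w : 'I_M -> R) (k l : nat) :
  (k <= l)%N -> cum_mass w l - cum_mass w k = \sum_(j : 'I_M | (k < j <= l)%N) w j.
Proof.
move=> kl; rewrite /cum_mass (bigID (fun j : 'I_M => (j <= k)%N)) /=.
rewrite (eq_bigl (fun j : 'I_M => (j <= k)%N)); last first.
  by move=> j; rewrite andb_idl // => jk; exact: leq_trans kl.
by rewrite addrAC subrr add0r; apply: eq_bigl => j; rewrite andbC ltnNge.
Qed.

(** Given the labels above [l], the remaining labels are independent, so the generating
    function of the number of labels at most [k] is that of a binomial variable, up to a
    constant that does not depend on [k]. *)
Lemma hidden_labels_genfun (R : realType) (n M : nat) (w : 'I_M -> R) (l : nat)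
    (h : {ffun 'I_n -> option 'I_M}) :
  exists c : R, forall k, (k <= l)%N ->
  \sum_(f : {ffun 'I_n -> 'I_M} | hide_below l f == h)
     (\prod_i w (f i))%:P * 'X^(count_le f k) =
  ((cum_mass w l - cum_mass w k)%:P + (cum_mass w k)%:P * 'X) ^+ count_hidden h
    * c%:P.
Proof.
exists (\prod_(i | h i != None) \sum_(j | hide_le l j == h i) w j) => k kl.
transitivity (\prod_i \sum_(j | hide_le l j == h i) (w j)%:P * 'X^(j <= k)%N).
  rewrite (bigA_distr_big_dep (fun i j => hide_le l j == h i)
            (fun i j => (w j)%:P * 'X^(j <= k)%N)).
  apply: eq_big => [f|f _].
    apply/eqP/familyP => [<- i|H]; first by rewrite unfold_in /= ffunE.
    by apply/ffunP => i; rewrite ffunE; exact/eqP/H.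
  rewrite big_split /= -rmorph_prod; congr (_ * _).
  by rewrite /count_le -expr_sum.
rewrite (bigID (fun i => h i == None)) /= rmorph_prod; congr (_ * _).
  rewrite (eq_bigr (fun=> (cum_mass w l - cum_mass w k)%:P + (cum_mass w k)%:P * 'X)).
    rewrite prodr_const; congr (_ ^+ _); rewrite /count_hidden -sum1_card big_mkcond.
    by apply: eq_bigr => i _; rewrite unfold_in; case: (h i).
  move=> i /eqP ->.
  rewrite (bigID (fun j : 'I_M => (j <= k)%N)) /= addrC; congr (_ + _).
    rewrite cum_mass_hide // rmorph_sum /=; apply: eq_big => [j|j /andP[_ /negbTE ->]].
      by rewrite /hide_le ltnNge; case: (j <= l)%N; rewrite ?andbT ?andbF.
    by rewrite expr0 mulr1.
  rewrite /cum_mass rmorph_sum big_distrl /=.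
  apply: eq_big => [j|j /andP[_ ->]]; last by rewrite expr1.
  rewrite /hide_le; case: (leqP j l) => //= jl.
  by rewrite leqNgt (leq_ltn_trans kl).
apply: eq_bigr => i hi; rewrite rmorph_sum /=; apply: eq_bigr => j /eqP jh.
have : ~~ (j <= l)%N by move: jh hi; rewrite /hide_le; case: ifP => // _ <-.
rewrite -ltnNge => lj; have -> : (j <= k)%N = false.
  by apply/negbTE; rewrite -ltnNge (leq_ltn_trans kl).
by rewrite expr0 mulr1.
Qed.

Lemma coef_binomial_expansion (R : realType) (a b : R) (m j : nat) :
  (((a%:P + b%:P * 'X) ^+ m)`_j = b ^+ j * a ^+ (m - j) *+ 'C(m, j)).
Proof.
rewrite exprDn coef_sum.
have [jm|mj] := leqP j m; last first.
  rewrite bin_small // mulr0n big1 // => i _.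
  rewrite coefMn -rmorphXn /= exprMn -rmorphXn /= coefCM coefCM coefXn.
  rewrite gtn_eqF ?mulr0 ?mul0rn //.
  by apply: leq_trans mj; rewrite ltnS -ltnS.
rewrite (bigD1 (Ordinal (jm : (j < m.+1)%N))) //= big1 ?addr0 => [|i ij].
  by rewrite coefMn -rmorphXn /= exprMn -rmorphXn /= coefCM coefCM coefXn eqxx mulr1 mulrC.
rewrite coefMn -rmorphXn /= exprMn -rmorphXn /= coefCM coefCM coefXn.
rewrite (_ : (j == i :> nat) = false) ?mulr0 ?mul0rn //.
by apply/negbTE; rewrite eq_sym; apply: contra ij => /eqP h; apply/eqP/val_inj.
Qed.

(** The Markov property of the counts at level [l]: conditionally on the labels above [l], the
    count at a lower level is binomial. *)
Lemma count_below_given_hidden (R : realType) (n M : nat) (w : 'I_M -> R) (k l m j : nat)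
    (B : pred {ffun 'I_n -> option 'I_M}) :
  (k <= l)%N -> cum_mass w l != 0 -> (forall h, B h -> count_hidden h = m) ->
  product_mass w (fun f => B (hide_below l f) && (count_le f k == j)) =
  binomial_pmf m (cum_mass w k / cum_mass w l) j *
    product_mass w (fun f : {ffun 'I_n -> 'I_M} => B (hide_below l f)).
Proof.
move=> kl l0 Bm; rewrite /product_mass.
rewrite (partition_big (hide_below l) B) /=; last by move=> f /andP[].
rewrite [in RHS](partition_big (hide_below l) B) //= big_distrr /=.
apply: eq_bigr => h Bh; have [c gf] := hidden_labels_genfun w l h.
have sumX k' j' : (k' <= l)%N ->
    \sum_(f | (hide_below l f == h) && (count_le f k' == j')) \prod_i w (f i) =
    cum_mass w k' ^+ j' * (cum_mass w l - cum_mass w k') ^+ (m - j') *+ 'C(m, j') * c.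
  move=> kl'; rewrite -(Bm _ Bh) -coef_binomial_expansion -coefMC -gf // coef_sum.
  rewrite big_mkcondr /=; apply: eq_bigr => f _; rewrite coefCM coefXn eq_sym.
  by case: eqP; rewrite ?mulr1 ?mulr0.
have -> : \sum_(f | B (hide_below l f) && (hide_below l f == h)) \prod_i w (f i) =
    cum_mass w l ^+ m * c.
  have := sumX l m (leqnn l); rewrite subrr subnn expr0 mulr1 binn mulr1n => <-.
  apply: eq_bigl => f; case: (hide_below l f =P h) => [fh|_]; rewrite ?andbF //= fh Bh /=.
  by rewrite -count_hiddenE fh Bm // eqxx.
rewrite (eq_bigl (fun f => (hide_below l f == h) && (count_le f k == j))); last first.
  by move=> f; case: (hide_below l f =P h) => [->|_]; rewrite ?andbF // Bh /= andbT.
rewrite sumX // mulrA; congr (_ * _).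
have [jm|mj] := leqP j m; last by rewrite /binomial_pmf bin_small // !mulr0n mul0r.
rewrite /binomial_pmf mulrnAl; congr (_ *+ _).
have -> : (cum_mass w k / cum_mass w l).~ = (cum_mass w l - cum_mass w k) / cum_mass w l.
  by rewrite /onem mulrBl divff.
rewrite -[in cum_mass w l ^+ m](subnKC jm) exprD !expr_div_n.
have lj : cum_mass w l ^+ j != 0 by rewrite expf_neq0.
have lmj : cum_mass w l ^+ (m - j) != 0 by rewrite expf_neq0.
move: (cum_mass w l ^+ j) lj (cum_mass w l ^+ (m - j)) lmj (cum_mass w k ^+ j)
  ((cum_mass w l - cum_mass w k) ^+ (m - j)) => C C0 D D0 E F.
by field; rewrite C0 D0.
Qed.

Lemma product_massE (R : realType) (n M : nat) (w : 'I_M -> R)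
    (A : pred {ffun 'I_n -> 'I_M}) :
  product_mass w A = \sum_f (A f)%:R * \prod_i w (f i).
Proof.
rewrite /product_mass big_mkcond; apply: eq_bigr => f _.
by case: (A f); rewrite ?mul1r ?mul0r.
Qed.

Lemma product_mass_ge0 (R : realType) (n M : nat) (w : 'I_M -> R)
    (A : pred {ffun 'I_n -> 'I_M}) :
  (forall j, 0 <= w j) -> 0 <= product_mass w A.
Proof. by move=> w0; apply: sumr_ge0 => f _; exact: prodr_ge0. Qed.

Lemma product_mass_le (R : realType) (n M : nat) (w : 'I_M -> R)
    (A B : pred {ffun 'I_n -> 'I_M}) :
  (forall j, 0 <= w j) -> (forall f, A f -> B f) ->
  product_mass w A <= product_mass w B.
Proof.
move=> w0 AB; rewrite !product_massE; apply: ler_sum => f _.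
apply: ler_wpM2r; first exact: prodr_ge0.
by rewrite ler_nat; case: (A f) (AB f) => // ->.
Qed.

(** The Markov property at a level that exceeds all labels. *)
Lemma count_le_binomial (R : realType) (n M : nat) (w : 'I_M -> R) (k j : nat) :
  \sum_j w j = 1 ->
  product_mass w (fun f : {ffun 'I_n -> 'I_M} => count_le f k == j) =
    binomial_pmf n (cum_mass w k) j.
Proof.
move=> w1; pose l := maxn k M.
have jl (i : 'I_M) : (i <= l)%N by rewrite leq_max (ltnW (ltn_ord i)) orbT.
have cl : cum_mass w l = 1.
  by rewrite /cum_mass -w1; apply: eq_bigl => i; exact: jl.
pose B : pred {ffun 'I_n -> option 'I_M} := fun h => h == [ffun=> None].
have BT f : B (hide_below l f).
  by apply/eqP/ffunP => i; rewrite !ffunE /hide_le jl.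
have Bn h : B h -> count_hidden h = n.
  move=> /eqP ->; rewrite /count_hidden (eq_bigr (fun=> 1%N)); last first.
    by move=> i _; rewrite ffunE.
  by rewrite sum_nat_const card_ord muln1.
have := @count_below_given_hidden R n M w k l n j B (leq_maxl _ _) _ Bn.
rewrite cl divr1 => /(_ (oner_neq0 _)).
rewrite (_ : product_mass w (fun f => B (hide_below l f)) = 1) ?mulr1; last first.
  rewrite /product_mass (eq_bigl xpredT) //.
  by rewrite -(bigA_distr_bigA (fun=> w)) big1 // => i _.
by move=> <-; apply: eq_bigl => f; rewrite BT.
Qed.

Definition hits (n M : nat) (W : pred nat) (f : {ffun 'I_n -> 'I_M}) : bool :=
  [exists k : 'I_n.+1, W k && (count_le f k == k)].

Definition last_hit (n M : nat) (W : pred nat) (l : nat)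
    (f : {ffun 'I_n -> 'I_M}) : bool :=
  [&& W l, count_le f l == l &
    [forall k : 'I_n.+1, (l < k)%N && W k ==> (count_le f k != k)]].

(** The last hit is determined by the counts from its own level upwards. *)
Lemma last_hit_hidden (n M : nat) (W : pred nat) (l : nat) :
  exists2 B : pred {ffun 'I_n -> option 'I_M},
    (forall f, last_hit W l f = B (hide_below l f)) &
    (forall h, B h -> count_hidden h = l).
Proof.
pose cnt (h : {ffun 'I_n -> option 'I_M}) k : nat :=
  (\sum_i (if h i is Some j then j <= k else true))%N.
exists (fun h => [&& W l, count_hidden h == l &
    [forall k : 'I_n.+1, (l < k)%N && W k ==> (cnt h k != k)]]).
  move=> f; rewrite /last_hit count_hiddenE; congr [&& _, _ & _].
  apply: eq_forallb => k; case: (ltnP l k) => //= lk.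
  rewrite (_ : count_le f k = cnt (hide_below l f) k) //.
  rewrite /count_le /cnt; apply: eq_bigr => i _; rewrite ffunE /hide_le; case: ifP => // fl.
  by rewrite (leq_trans fl (ltnW lk)).
by move=> h /and3P[_ /eqP].
Qed.

Lemma sum_last_hit (n M : nat) (W : pred nat) (f : {ffun 'I_n -> 'I_M}) :
  (\sum_(l < n.+1) last_hit W l f)%N = hits W f.
Proof.
have [/existsP[k0 hk0]|/existsPn H] := boolP (hits W f); last first.
  rewrite big1 // => l _; apply/eqP; rewrite eqb0; apply/negP => /and3P[Wl fl _].
  by have := H l; rewrite Wl fl.
pose P (k : 'I_n.+1) := W k && (count_le f k == k).
case: (@arg_maxnP _ k0 P (fun k => nat_of_ord k) hk0) => l Pl lmax.
have ll : last_hit W l f.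
  have /andP[Wl fl] := Pl; apply/and3P; split=> //.
  apply/forallP => k; apply/implyP => /andP[lk Wk]; apply/negP => fk.
  by have := lmax k; rewrite /P Wk fk => /(_ isT) /=; rewrite leqNgt lk.
rewrite (bigD1 l) //= ll big1 ?addn0 // => m ml; apply/eqP; rewrite eqb0.
apply/negP => /and3P[Wm fm /forallP/(_ l)].
have /andP[Wl fl] := Pl; rewrite Wl fl andbT implybF -leqNgt => lm.
have lem : (m <= l)%N by apply: lmax; rewrite /P Wm fm.
by move: ml; rewrite -val_eqE /= eqn_leq lm lem.
Qed.

Lemma product_mass_hits (R : realType) (n M : nat) (w : 'I_M -> R) (W : pred nat) :
  product_mass w (fun f : {ffun 'I_n -> 'I_M} => hits W f) =
  \sum_(l < n.+1) product_mass w (fun f : {ffun 'I_n -> 'I_M} => last_hit W l f).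
Proof.
rewrite product_massE; under [RHS]eq_bigr do rewrite product_massE.
rewrite exchange_big /=; apply: eq_bigr => f _.
by rewrite -big_distrl /= -natr_sum sum_last_hit.
Qed.

(** A hit at [k] implies that the last hit is at some [l >= k], and conditionally on it the
    hit at [k] has a binomial probability by the Markov property. *)
Lemma last_hit_decomposition (R : realType) (n M : nat) (w : 'I_M -> R) (W : pred nat) :
  \sum_j w j = 1 -> (forall l, W l -> cum_mass w l != 0) ->
  \sum_(k < n.+1 | W k) binomial_pmf n (cum_mass w k) k =
  \sum_(l < n.+1) product_mass w (fun f : {ffun 'I_n -> 'I_M} => last_hit W l f) *
     \sum_(k < l.+1 | W k) binomial_pmf l (cum_mass w k / cum_mass w l) k.
Proof.
move=> w1 W0.
transitivity (\sum_(k < n.+1 | W k) \sum_(l < n.+1 | (k <= l)%N)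
   product_mass w (fun f : {ffun 'I_n -> 'I_M} => last_hit W l f && (count_le f k == k))).
  apply: eq_bigr => k Wk; rewrite -(count_le_binomial n k k w1) product_massE.
  under [RHS]eq_bigr do rewrite product_massE.
  rewrite exchange_big /=; apply: eq_bigr => f _.
  rewrite -big_distrl /= -natr_sum; congr (_%:R * _).
  case: (boolP (count_le f k == k)) => fk; last by rewrite big1 // => l _; rewrite andbF.
  under eq_bigr do rewrite andbT.
  have : hits W f by apply/existsP; exists k; rewrite Wk.
  have := sum_last_hit W f => + hf; rewrite hf => <-.
  rewrite [LHS](bigID (fun l : 'I_n.+1 => (k <= l)%N)) /= [X in (_ + X)%N]big1 ?addn0 //.
  move=> l lk; apply/eqP; rewrite eqb0; apply/negP => /and3P[_ _ /forallP/(_ k)].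
  by rewrite Wk fk ltnNge lk.
rewrite (exchange_big_dep xpredT) //=; apply: eq_bigr => l _.
rewrite big_distrr /= [RHS](big_ord_widen_cond n.+1 W (fun k =>
  product_mass w (fun f : {ffun 'I_n -> 'I_M} => last_hit W l f) *
  binomial_pmf l (cum_mass w k / cum_mass w l) k)) //.
under [RHS]eq_bigl do rewrite ltnS.
have [Wl|nWl] := boolP (W l); last first.
  rewrite !big1 //= => k _; rewrite /product_mass big_pred0 ?mul0r // => f.
    by rewrite /last_hit (negbTE nWl).
  by rewrite /last_hit (negbTE nWl).
apply: eq_bigr => k /andP[_ kl].
have [B BE Bl] := last_hit_hidden n M W l.
have := count_below_given_hidden k kl (W0 _ Wl) Bl; rewrite /product_mass.
under eq_bigl do rewrite -BE.
by under [X in _ = _ * X -> _]eq_bigl do rewrite -BE; move=> ->; rewrite mulrC.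
Qed.

(** * The expected number of hits in a window *)

Definition in_window (R : realType) (x d : R) (n : nat) : pred nat :=
  fun k => `|x - k%:R / n%:R| < d.

Definition window_lo (R : realType) (x d : R) (n : nat) : nat :=
  (Num.truncn (n%:R * (x - d))).+1.

Definition window_hi (R : realType) (x d : R) (n : nat) : nat :=
  `|Num.ceil (n%:R * (x + d))|%N.

Lemma in_windowE (R : realType) (x d : R) (n k : nat) : (0 < n)%N ->
  0 <= x - d -> 0 < d ->
  in_window x d n k = (window_lo x d n <= k < window_hi x d n)%N.
Proof.
move=> n0 xd d0; have nR : (0 : R) < n%:R by rewrite ltr0n.
have hi0 : 0 <= Num.ceil (n%:R * (x + d)).
  by rewrite ceil_ge0 (@lt_le_trans _ _ 0) ?ltrN10 // mulr_ge0 ?ltW //; lra.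
rewrite /in_window /window_lo truncn_lt_nat; last by rewrite mulr_ge0 // ltW.
rewrite -[(k < _)%N]ltz_nat /window_hi gez0_abs // ceil_gt_int.
rewrite distrC ltr_distl ltr_pdivlMr // ltr_pdivrMr //.
by rewrite ![_ * n%:R]mulrC.
Qed.

Lemma window_hi_bounds (R : realType) (x d : R) (n : nat) : (0 < n)%N ->
  0 <= x -> 0 < d ->
  x + d <= (window_hi x d n)%:R / n%:R < x + d + n%:R^-1.
Proof.
move=> n0 x0 d0; have nR : (0 : R) < n%:R by rewrite ltr0n.
have hi0 : 0 <= Num.ceil (n%:R * (x + d)).
  by rewrite ceil_ge0 (@lt_le_trans _ _ 0) ?ltrN10 // mulr_ge0 ?ltW //; lra.
have := ceil_itv (n%:R * (x + d)); rewrite -(gez0_abs hi0) -/(window_hi x d n).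
rewrite intrB /= => /andP[h1 h2].
rewrite ler_pdivlMr // ltr_pdivrMr // [(_ + n%:R^-1) * _]mulrDl mulVf ?gt_eqF //.
by rewrite [(x + d) * _]mulrC h2 /= -ltrBlDr.
Qed.

Lemma window_lo_bounds (R : realType) (x d : R) (n : nat) : (0 < n)%N ->
  0 <= x - d ->
  x - d < (window_lo x d n)%:R / n%:R <= x - d + n%:R^-1.
Proof.
move=> n0 xd; have nR : (0 : R) < n%:R by rewrite ltr0n.
have nxd : 0 <= n%:R * (x - d) by rewrite mulr_ge0 // ltW.
have /andP[h1 h2] := truncn_itv nxd.
rewrite ltr_pdivlMr // ler_pdivrMr // [(_ + n%:R^-1) * _]mulrDl mulVf ?gt_eqF //.
rewrite ![(x - d) * _]mulrC.
by rewrite h2 /= /window_lo -natr1 lerD2r.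
Qed.

(** Chernoff bound with [h = u/2]. *)
Lemma binomial_tail_near1 (R : realType) (n k : nat) (p u : R) :
  (k <= n)%N -> (0 < n)%N -> 0 <= p <= 1 -> 0 < u -> k%:R / n%:R + u <= p ->
  1 - binomial_tail n p k.+1 <= expR (- (u / 2) ^+ 2) ^+ n.
Proof.
move=> kn n0 p01 u0 kp; have nR : (0 : R) < n%:R by rewrite ltr0n.
have h0 : 0 < u / 2 by lra.
apply: le_trans (chernoff_lower p01 (ltW h0) _) _; first by rewrite ltnS.
rewrite -expRM_natl ler_expR subSS natrB //.
set s := k%:R / n%:R in kp; have -> : k%:R = n%:R * s :> R.
  by rewrite /s mulrCA divff ?mulr1 // gt_eqF.
have s1 : s <= 1 by rewrite /s ler_pdivrMr // mul1r ler_nat.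
have s0 : 0 <= s by rewrite divr_ge0 // ltW.
have [h hE] : exists h, u / 2 = h by exists (u / 2).
rewrite hE in h0 *.
have -> : h * (n%:R * (1 - p) - (n%:R - n%:R * s) / (1 + h)) =
    n%:R * (h * (1 - p - (1 - s) / (1 + h))) by ring.
rewrite ler_pM2l //.
have : (1 - s) / (1 + h) >= (1 - s) * (1 - h).
  rewrite ler_pdivlMr; last lra.
  rewrite -mulrA ler_piMr ?subr_ge0 //; nra.
move: ((1 - s) / (1 + h)) => q hq.
rewrite expr2 -mulrN ler_pM2l //.
have sh : (1 - s) * h <= h by rewrite ler_piMl ?(ltW h0) //; lra.
lra.
Qed.

Lemma binomial_tail_near0 (R : realType) (n k : nat) (p u : R) :
  (k <= n)%N -> (0 < n)%N -> 0 <= p <= 1 -> 0 < u -> p + u <= k%:R / n%:R ->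
  binomial_tail n p k.+1 <= expR (- (u / 2) ^+ 2) ^+ n.
Proof.
move=> kn n0 p01 u0 kp; have nR : (0 : R) < n%:R by rewrite ltr0n.
have h0 : 0 < u / 2 by lra.
apply: le_trans (chernoff_upper n k.+1 p01 (ltW h0)) _.
rewrite -expRM_natl ler_expR -[k.+1%:R]natr1.
set s := k%:R / n%:R in kp; have -> : k%:R = n%:R * s :> R.
  by rewrite /s mulrCA divff ?mulr1 // gt_eqF.
have s1 : s <= 1 by rewrite /s ler_pdivrMr // mul1r ler_nat.
have s0 : 0 <= s by rewrite divr_ge0 // ltW.
have [h hE] : exists h, u / 2 = h by exists (u / 2).
rewrite hE in h0 *.
apply: (@le_trans _ _ (n%:R * (h * (p - s / (1 + h))))).
  rewrite [leRHS](_ : _ = h * (n%:R * p - n%:R * s / (1 + h))); last by ring.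
  rewrite ler_pM2l // lerD2l lerN2 ler_pM2r ?invr_gt0 //; lra.
rewrite ler_pM2l //.
have : s / (1 + h) >= s * (1 - h).
  rewrite ler_pdivlMr; last lra.
  rewrite -mulrA ler_piMr //; nra.
move: (s / (1 + h)) => q hq.
rewrite expr2 -mulrN ler_pM2l //.
have sh : s * h <= h by rewrite ler_piMl ?(ltW h0).
lra.
Qed.

Definition transversal_crossing (R : realType) (pi : R -> R) (x a : R) : Prop :=
  [/\ 0 < x < 1, pi x = x, 1 < a, strict_slope pi x a &
      forall y, 0 <= pi y <= 1].

Definition hit_mass (R : realType) (pi : R -> R) (n k : nat) : R :=
  binomial_pmf n (pi (k%:R / n%:R)) k.

Definition above_mass (R : realType) (pi : R -> R) (n k : nat) : R :=
  binomial_tail n (pi (k%:R / n%:R)) k.+1.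

Lemma hit_mass_ge0 (R : realType) (pi : R -> R) (n k : nat) :
  (forall y, 0 <= pi y <= 1) -> 0 <= hit_mass pi n k.
Proof. by move=> pi01; exact: binomial_pmf_ge0. Qed.

Lemma above_mass_bounds (R : realType) (pi : R -> R) (n k : nat) :
  (forall y, 0 <= pi y <= 1) -> 0 <= above_mass pi n k <= 1.
Proof. by move=> pi01; exact: binomial_tail_le1. Qed.

Lemma crossing_gap (R : realType) (pi : R -> R) (x a : R) :
  transversal_crossing pi x a ->
  exists2 d : R, 0 < d & forall y, `|x - y| < d ->
    (x <= y -> y + (a - 1) / 2 * (y - x) <= pi y) /\
    (y <= x -> pi y + (a - 1) / 2 * (x - y) <= y).
Proof.
move=> [x01 pix a1 ss _]; have a2 : 0 < (a - 1) / 2 by lra.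
have [d d0 H] := ss _ a2; exists d => // y yd.
have xd : `|x - x| < d by rewrite subrr normr0.
split=> xy.
  by have /andP[h _] := H _ _ xd yd xy; rewrite pix in h; lra.
by have /andP[h _] := H _ _ yd xd xy; rewrite pix in h; lra.
Qed.

Lemma cvg_expr_squeeze (R : realType) (u : nat -> R) (g : R) : 0 <= g < 1 ->
  (\forall n \near \oo, 0 <= u n <= g ^+ n) -> u n @[n --> \oo] --> (0 : R).
Proof.
move=> /andP[g0 g1] H; apply: (squeeze_cvgr H); first exact: cvg_cst.
by apply: cvg_expr; rewrite ger0_norm.
Qed.

(** Inside such a radius the expected hits are controlled by the increments of [above_mass],
    and these telescope to 1 over every smaller window. *)
Definition good_radius (R : realType) (pi : R -> R) (x a e0 : R) : Prop :=
  [/\ 0 < e0, e0 < x, x + e0 < 1,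
   (\forall n \near \oo, forall k, in_window x e0 n k ->
     (a - 1) / 2 * hit_mass pi n k <= above_mass pi n k.+1 - above_mass pi n k) &
   (forall d, 0 < d <= e0 ->
     above_mass pi n (window_hi x d n) @[n --> \oo] --> (1 : R) /\
     above_mass pi n (window_lo x d n) @[n --> \oo] --> (0 : R))].

(** The increments dominate by [crossing_rate] with an error of half the rate. At the ends of a
    window [pi y] differs from [y] by a positive amount, which makes the tails degenerate
    exponentially fast. *)
Lemma exists_good_radius (R : realType) (pi : R -> R) (x a : R) :
  transversal_crossing pi x a -> exists e0 : R, good_radius pi x a e0.
Proof.
move=> tc; have [/andP[x0 x1] pix a1 ss pi01] := tc.
have a2 : 0 < (a - 1) / 2 by lra.
have [d1 d10 gap] := crossing_gap tc.
have a0 : 0 < a by lra.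
have [|N [d2 d20 rate]] := crossing_rate _ pix a0 ss a2; first by rewrite x0.
pose e0 := Num.min (Num.min d1 d2) (Num.min x (1 - x)) / 2.
have [e00 ed1 ed2 ex ex1] : [/\ 0 < e0, 2 * e0 <= d1, 2 * e0 <= d2, 2 * e0 <= x &
    2 * e0 <= 1 - x].
  rewrite /e0 mulrCA divff ?mulr1 ?pnatr_eq0 // !ge_min !lexx ?orbT; split => //.
  by rewrite divr_gt0 // !lt_min d10 d20 x0 subr_gt0 x1.
have invn (e : R) : 0 < e -> \forall n \near \oo, n%:R^-1 < e.
  by move=> e0'; apply: cvgr_lt e0'; exact: cvgn_inv_nat.
exists e0; split => //; [lra|lra| |].
  near=> n => k; rewrite /in_window => kw.
  have nN : (N <= n)%N by near: n; exists N.
  have kd2 : `|x - k%:R / n%:R| < d2 by lra.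
  have := rate n k nN kd2.
  rewrite /= -/(hit_mass pi n k) -/(above_mass pi n k) -/(above_mass pi n k.+1).
  by rewrite ler_norml => /andP[h _]; lra.
move=> d /andP[d0 de].
have gu : 0 <= expR (- ((a - 1) / 2 * (d / 2) / 2) ^+ 2) < 1.
  rewrite expR_ge0 expR_lt1 oppr_lt0 exprn_gt0 //.
  by rewrite divr_gt0 // mulr_gt0 //; lra.
split.
  have : 1 - above_mass pi n (window_hi x d n) @[n --> \oo] --> (0 : R).
    apply: (cvg_expr_squeeze gu); near=> n.
    have n0 : (0 < n)%N by near: n; exists 1%N.
    have /andP[h1 h2] := window_hi_bounds n0 (ltW x0) d0.
    have nd : n%:R^-1 < e0 by near: n; exact: invn.
    have /andP[T0 T1] := above_mass_bounds n (window_hi x d n) pi01.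
    apply/andP; split; first by rewrite subr_ge0.
    set y := (window_hi x d n)%:R / n%:R in h1 h2.
    have yx : x <= y by lra.
    have yd1 : `|x - y| < d1.
      by rewrite distrC ger0_norm; clear - yx h2 de nd ed1; lra.
    have [/(_ yx) g _] := gap _ yd1.
    apply: binomial_tail_near1 => //.
    - by rewrite -(ler_nat R) -[leRHS]mul1r -ler_pdivrMr ?ltr0n // -/y; lra.
    - by rewrite mulr_gt0 //; lra.
    - rewrite -/y; nra.
  move=> H1; have : 1 - (1 - above_mass pi n (window_hi x d n)) @[n --> \oo] --> 1 - (0 : R).
    by apply: cvgB => //; exact: cvg_cst.
  rewrite subr0; under eq_fun do rewrite subKr.
  by [].
apply: (cvg_expr_squeeze gu); near=> n.
have n0 : (0 < n)%N by near: n; exists 1%N.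
have xd : 0 <= x - d by lra.
have /andP[h1 h2] := window_lo_bounds n0 xd.
have nd : n%:R^-1 < d / 2 by near: n; apply: invn; lra.
have /andP[T0 T1] := above_mass_bounds n (window_lo x d n) pi01.
rewrite T0 /=.
set y := (window_lo x d n)%:R / n%:R in h1 h2.
have yx : y <= x by lra.
have yd1 : `|x - y| < d1 by rewrite ger0_norm; clear - yx h1 de ed1 e00; lra.
have [_ /(_ yx) g] := gap _ yd1.
apply: binomial_tail_near0 => //.
- by rewrite -(ler_nat R) -[leRHS]mul1r -ler_pdivrMr ?ltr0n // -/y; lra.
- by rewrite mulr_gt0 //; lra.
- rewrite -/y; nra.
Unshelve. all: by end_near. Qed.

Lemma sum_in_window (R : realType) (x d : R) (n : nat) (F : nat -> R) :
  (0 < n)%N -> 0 <= x - d -> 0 < d -> x + d + n%:R^-1 <= 1 ->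
  \sum_(k < n.+1 | in_window x d n k) F k =
  \sum_(window_lo x d n <= k < window_hi x d n) F k.
Proof.
move=> n0 xd d0 xd1.
have x0 : 0 <= x by lra.
have hin : (window_hi x d n <= n.+1)%N.
  have /andP[_ h] := window_hi_bounds n0 x0 d0.
  apply: leqW; rewrite -(ler_nat R) -[leRHS]mul1r -ler_pdivrMr ?ltr0n //.
  by apply: ltW; apply: lt_le_trans xd1.
rewrite -(big_mkord (in_window x d n) F) big_mkcond /=.
rewrite (eq_bigr (fun k => if (window_lo x d n <= k < window_hi x d n)%N then F k else 0));
  last by move=> k _; rewrite in_windowE.
rewrite -big_mkcond /= [RHS](big_nat_widen _ _ n.+1) //= [RHS](big_nat_widenl _ 0%N) //=.
by apply: eq_bigl => k; rewrite andbC.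
Qed.

Lemma near_window_regular (R : realType) (x d : R) : 0 < d -> x + d < 1 ->
  \forall n \near \oo, (0 < n)%N /\ x + d + n%:R^-1 <= 1 /\ n%:R^-1 <= d.
Proof.
move=> d0 xd; have invn (e : R) : 0 < e -> \forall n \near \oo, n%:R^-1 < e.
  by move=> e0'; apply: cvgr_lt e0'; exact: cvgn_inv_nat.
near=> n; split; first by near: n; exists 1%N.
split.
  have : n%:R^-1 < 1 - (x + d) by near: n; apply: invn; lra.
  by lra.
by apply: ltW; near: n; exact: invn.
Unshelve. all: by end_near. Qed.

Lemma window_increments_cvg (R : realType) (pi : R -> R) (x a e0 d : R) :
  good_radius pi x a e0 -> 0 < d <= e0 ->
  \sum_(k < n.+1 | in_window x d n k) (above_mass pi n k.+1 - above_mass pi n k)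
    @[n --> \oo] --> (1 : R).
Proof.
move=> [e00 ex ex1 _ lims] de; have [h1 h0] := lims _ de; have /andP[d0 de0] := de.
have H : above_mass pi n (window_hi x d n) - above_mass pi n (window_lo x d n)
    @[n --> \oo] --> 1 - (0 : R) by apply: cvgB.
rewrite subr0 in H; apply: cvg_trans H; apply: near_eq_cvg; near=> n.
have [n0 [nx nd]] : (0 < n)%N /\ x + d + n%:R^-1 <= 1 /\ n%:R^-1 <= d.
  by near: n; apply: near_window_regular => //; lra.
have xd : 0 <= x - d by lra.
rewrite (sum_in_window (fun k => above_mass pi n k.+1 - above_mass pi n k) n0 xd d0 nx).
rewrite telescope_sumr // -(ler_nat R).
have nR : (0 : R) < n%:R^-1 by rewrite invr_gt0 ltr0n.
have /andP[_ hl] := window_lo_bounds n0 xd.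
have x0 : 0 <= x by lra.
have /andP[hh _] := window_hi_bounds n0 x0 d0.
by rewrite -(ler_pM2r nR); lra.
Unshelve. all: by end_near. Qed.

Lemma in_window_mono (R : realType) (x d e : R) (n k : nat) : d <= e ->
  in_window x d n k -> in_window x e n k.
Proof. by move=> de; rewrite /in_window => /lt_le_trans; apply. Qed.

Lemma sum_window_shell (R : realType) (x d e : R) (n : nat) (F : nat -> R) : d <= e ->
  \sum_(k < n.+1 | in_window x e n k) F k =
  \sum_(k < n.+1 | in_window x d n k) F k +
  \sum_(k < n.+1 | in_window x e n k && ~~ in_window x d n k) F k.
Proof.
move=> de; rewrite (bigID (fun k : 'I_n.+1 => in_window x d n k)) /=; congr (_ + _).
apply: eq_bigl => k; case: (boolP (in_window x d n k)); rewrite ?andbF ?andbT //.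
exact: in_window_mono.
Qed.

(** The increments of [above_mass] already sum to 1 over the inner window in the limit, so
    nothing is left for the shell. *)
Lemma shell_hit_mass_cvg0 (R : realType) (pi : R -> R) (x a e0 d e : R) :
  1 < a -> (forall y, 0 <= pi y <= 1) ->
  good_radius pi x a e0 -> 0 < d -> d <= e -> e <= e0 ->
  \sum_(k < n.+1 | in_window x e n k && ~~ in_window x d n k) hit_mass pi n k
    @[n --> \oo] --> (0 : R).
Proof.
move=> a1 pi01 gr d0 de ee0; have [e00 ex ex1 incr _] := gr.
have de0 : 0 < d <= e0 by rewrite d0 (le_trans de).
have ee0' : 0 < e <= e0 by rewrite (lt_le_trans d0 de).
pose I n k := above_mass pi n k.+1 - above_mass pi n k.
have H : (2 / (a - 1)) * (\sum_(k < n.+1 | in_window x e n k) I n k -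
    \sum_(k < n.+1 | in_window x d n k) I n k) @[n --> \oo] --> 2 / (a - 1) * (1 - 1 : R).
  apply: cvgM; first exact: cvg_cst.
  by apply: cvgB; [exact: window_increments_cvg gr ee0'|exact: window_increments_cvg gr de0].
rewrite subrr mulr0 in H.
apply: (squeeze_cvgr _ (cvg_cst (0 : R)) H); near=> n.
rewrite sumr_ge0 /=; last by move=> k _; exact: hit_mass_ge0.
rewrite (sum_window_shell x n (I n) de) addrAC subrr add0r big_distrr /=.
apply: ler_sum => k /andP[ke _].
have a2 : 0 < (a - 1) / 2 by lra.
rewrite -(ler_pM2l a2) mulrA.
have -> : (a - 1) / 2 * (2 / (a - 1)) = 1 by field; lra.
rewrite mul1r /I; move: (nat_of_ord k) (in_window_mono ee0 ke); near: n.
exact: incr.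
Unshelve. all: by end_near. Qed.

(** On a smaller window [d] the increments are [(a - 1) hit_mass] up to an arbitrarily small
    relative error, and they sum to 1; the rest of the window is negligible. *)
Lemma window_hit_mass_cvg (R : realType) (pi : R -> R) (x a e0 e : R) :
  transversal_crossing pi x a -> good_radius pi x a e0 -> 0 < e <= e0 ->
  \sum_(k < n.+1 | in_window x e n k) hit_mass pi n k @[n --> \oo] --> (a - 1)^-1.
Proof.
move=> [/andP[x0 x1] pix a1 ss pi01] gr /andP[e00 ee0].
have [e0p ex ex1 incr _] := gr.
have a1' : 0 < a - 1 by lra.
apply/cvgrPdist_le => eta eta0.
pose eta1 := eta / 4 * (a - 1) * ((a - 1) / 2).
have eta10 : 0 < eta1 by rewrite /eta1 !mulr_gt0 //; lra.
have a0 : 0 < a by lra.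
have [|N [d1 d10 rate]] := crossing_rate _ pix a0 ss eta10; first by rewrite x0.
pose d := Num.min d1 e.
have d0 : 0 < d by rewrite lt_min d10.
have [dd1 de] : d <= d1 /\ d <= e by rewrite /d !ge_min !lexx orbT.
have de0 : 0 < d <= e0 by rewrite d0 (le_trans de).
pose I n k := above_mass pi n k.+1 - above_mass pi n k.
have cI := window_increments_cvg gr de0.
have cS := shell_hit_mass_cvg0 a1 pi01 gr d0 de ee0.
near=> n.
have incr_n : forall k, in_window x e0 n k -> (a - 1) / 2 * hit_mass pi n k <= I n k.
  by near: n; exact: incr.
rewrite (sum_window_shell x n (hit_mass pi n) de).
set B := \sum_(k < n.+1 | in_window x d n k) hit_mass pi n k.
set S := \sum_(k < n.+1 | _) hit_mass pi n k.
have hS : `|0 - S| <= eta / 4.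
  by rewrite /S; near: n; apply: (cvgr_dist_le _ _ cS); lra.
pose Z := \sum_(k < n.+1 | in_window x d n k) I n k.
have hZ : `|1 - Z| <= eta / 4 * (a - 1).
  by rewrite /Z; near: n; apply: (cvgr_dist_le _ _ cI); rewrite mulr_gt0 //; lra.
have hZ1 : `|1 - Z| <= 1.
  by rewrite /Z; near: n; apply: (cvgr_dist_le _ _ cI).
have nN : (N <= n)%N by near: n; exists N.
have hB : (a - 1) / 2 * B <= Z.
  rewrite big_distrr /=; apply: ler_sum => k kd; apply: incr_n.
  by apply: in_window_mono kd; have /andP[] := de0.
have hZB : `|Z - (a - 1) * B| <= eta1 * B.
  rewrite /B !big_distrr -sumrB /=; apply: le_trans (ler_norm_sum _ _ _) _.
  apply: ler_sum => k kd; apply: (rate n k nN).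
  exact: lt_le_trans kd dd1.
have B0 : 0 <= B by apply: sumr_ge0 => k _; exact: hit_mass_ge0.
have B2 : (a - 1) / 2 * B <= 2.
  by move: hZ1; rewrite ler_norml => /andP[k1 k2]; clear - hB k1 k2; lra.
have hZB' : `|Z - (a - 1) * B| <= eta / 2 * (a - 1).
  apply: le_trans hZB _; rewrite /eta1 -[leLHS]mulrA.
  apply: (@le_trans _ _ (eta / 4 * (a - 1) * 2)); last by clear; lra.
  by rewrite ler_pM2l // mulr_gt0 //; clear - eta0; lra.
have h1 : `|1 - (a - 1) * B| <= 3 / 4 * eta * (a - 1).
  move: hZB' hZ; rewrite !ler_norml => /andP[k1 k2] /andP[k3 k4]; apply/andP.
  clear - k1 k2 k3 k4; lra.
have h2 : `|(a - 1)^-1 - B| <= 3 / 4 * eta.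
  have -> : (a - 1)^-1 - B = (1 - (a - 1) * B) / (a - 1) by clear - a1'; field; lra.
  by rewrite normrM [`|(a - 1)^-1|]gtr0_norm ?invr_gt0 // ler_pdivrMr.
move: h2 hS; rewrite !ler_norml => /andP[k1 k2] /andP[k3 k4]; apply/andP.
clear - k1 k2 k3 k4; lra.
Unshelve. all: by end_near. Qed.

(** * From expected hits to the probability of a hit *)

Lemma sum_window_below (R : realType) (x d : R) (n l : nat) (F : nat -> R) :
  (0 < n)%N -> 0 <= x - d -> 0 < d -> in_window x d n l ->
  \sum_(k < l.+1 | in_window x d n k) F k =
  \sum_(0 <= j < l.+1 - window_lo x d n) F (l - j)%N.
Proof.
move=> n0 xd d0; rewrite in_windowE // => /andP[lol lhi].
rewrite -(big_mkord (in_window x d n) F).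
transitivity (\sum_(window_lo x d n <= k < l.+1) F k).
  rewrite [RHS](big_nat_widenl _ 0%N) //= big_nat_cond [RHS]big_nat_cond.
  apply: eq_bigl => k; case: (ltnP k l.+1) => //= kl; rewrite ?andbF //.
  by rewrite in_windowE // (leq_ltn_trans _ lhi) ?andbT // -ltnS.
rewrite big_nat_rev /= -{1}[window_lo x d n]add0n big_addn.
by apply: eq_big_nat => j /andP[_ jl]; congr F; lia.
Qed.

Lemma sum_binomial_pmf_nat_le (R : realType) (K m : nat) (q : nat -> R) (F : nat -> nat) :
  (forall j, (j < K)%N -> 0 <= q j <= 1) ->
  0 <= \sum_(0 <= j < K) binomial_pmf m (q j) (F j) <= K%:R.
Proof.
move=> q01; apply/andP; split.
  rewrite big_nat_cond; apply: sumr_ge0 => j /andP[/andP[_ jK] _].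
  exact/binomial_pmf_ge0/q01.
apply: (@le_trans _ _ (\sum_(0 <= j < K) (1 : R))).
  rewrite big_nat_cond [leRHS]big_nat_cond; apply: ler_sum => j /andP[/andP[_ jK] _].
  exact/binomial_pmf_le1/q01.
by rewrite sumr_const_nat subn0.
Qed.

Lemma sub_in_interval (lo hi l j : nat) : (lo <= l)%N -> (l < hi)%N ->
  (j < l.+1 - lo)%N -> (j <= l)%N /\ (lo <= l - j < hi)%N.
Proof. lia. Qed.

(** For [k] and [l] in a narrow window, [pi (k/n) / pi (l/n)] is [1 - beta j / l] with [j = l - k]
    and [beta] close to [a], so the sum counts returns of the supercritical walk. When [l] is
    near the lower end of the window, the sum has few terms and is merely bounded. *)
Lemma returns_in_window (R : realType) (pi : R -> R) (x a theta eta e : R) :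
  transversal_crossing pi x a -> 0 < theta < 1 ->
  theta * expR (- theta) = a * expR (- a) -> 0 < eta -> 0 < e ->
  exists2 d, 0 < d <= e & exists2 C : R, 0 <= C &
  \forall n \near \oo, forall l, in_window x d n l ->
    let s := \sum_(k < l.+1 | in_window x d n k)
        binomial_pmf l (pi (k%:R / n%:R) / pi (l%:R / n%:R)) k in
    [/\ 0 < pi (l%:R / n%:R), `|s - (1 - theta)^-1| <= C &
      in_window x (d / 2) n l -> `|s - (1 - theta)^-1| <= eta].
Proof.
move=> [/andP[x0 x1] pix a1 ss pi01] t01 tE eta0 e0.
have /andP[t0 t1] := t01.
have [delta del0 [M _ /(_ M (leqnn M)) HM]] := sum_returns_supercritical a1 t01 tE eta0.
have a0 : 0 < a by lra.
pose e1 := Num.min (delta / 4) (Num.min 1 a).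
have e10 : 0 < e1 by rewrite /e1 !lt_min a0 ltr01; lra.
have [e1d e11 e1a] : [/\ e1 <= delta / 4, e1 <= 1 & e1 <= a].
  by rewrite /e1 !ge_min !lexx !orbT.
have [d1 d10 slope] := ss _ e10.
pose e2 := delta / (4 * (a + 1)).
have e20 : 0 < e2 by rewrite divr_gt0 // mulr_gt0 //; lra.
have pic : pi y @[y --> x] --> x by rewrite -{2}pix; exact: strict_slope_cvg ss.
have cratio : y / pi y @[y --> x] --> (1 : R).
  have -> : 1 = x / x by field; lra.
  by apply: cvgM; [exact: cvg_id|apply: cvgV => //; rewrite gt_eqF].
have : \forall y \near x, 0 < pi y /\ `|1 - y / pi y| <= e2.
  near=> y; split; near: y; first exact: (cvgr_gt x).
  exact: (cvgr_dist_le _ _ cratio).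
move=> /nbhs_ballP[d2 /= d20 ratio].
pose d := Num.min (Num.min d1 d2) (Num.min e (x / 2)).
have d0 : 0 < d by rewrite /d !lt_min d10 d20 e0 divr_gt0.
have [dd1 dd2 de dx] : [/\ d <= d1, d <= d2, d <= e & d <= x / 2].
  by rewrite /d !ge_min !lexx !orbT.
have L0 : 0 < (1 - theta)^-1 by rewrite invr_gt0; lra.
exists d; first by rewrite d0.
exists (M%:R + (1 - theta)^-1 + eta); first by rewrite !addr_ge0 // ltW.
have invn (z : R) : 0 < z -> \forall n \near \oo, n%:R^-1 < z.
  by move=> z0; apply: cvgr_lt z0; exact: cvgn_inv_nat.
near=> n => l lW /=; set s := \sum_(k < l.+1 | _) _.
have n0 : (0 < n)%N by near: n; exists 1%N.
have nR : (0 : R) < n%:R by rewrite ltr0n.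
have xd : 0 <= x - d by lra.
have [pl0 rl] : 0 < pi (l%:R / n%:R) /\ `|1 - (l%:R / n%:R) / pi (l%:R / n%:R)| <= e2.
  by apply: ratio; apply: lt_le_trans lW _.
set pl := pi (l%:R / n%:R) in s pl0 rl *.
have lW' := lW; rewrite in_windowE // in lW'; have /andP[lol lhi] := lW'.
pose K := (l.+1 - window_lo x d n)%N.
have l0 : (0 < l)%N by apply: leq_trans lol; rewrite /window_lo.
have lR : (0 : R) < l%:R by rewrite ltr0n.
pose q j := 1 - pi ((l - j)%:R / n%:R) / pl.
have jW j : (j < K)%N -> in_window x d n (l - j)%N.
  by move=> jK; rewrite in_windowE //; have [] := sub_in_interval lol lhi jK.
have jl j : (j < K)%N -> (j <= l)%N by move=> jK; have [] := sub_in_interval lol lhi jK.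
have sl j : (j < K)%N -> (a - e1) * (j%:R / n%:R) <= pl - pi ((l - j)%:R / n%:R)
    <= (a + e1) * (j%:R / n%:R).
  move=> jK.
  have E : l%:R / n%:R - (l - j)%:R / n%:R = j%:R / n%:R :> R.
    by rewrite (natrB _ (jl _ jK)) -mulrBl opprB addrC subrK.
  have w1 : `|x - (l - j)%:R / n%:R| < d1 by apply: lt_le_trans dd1; exact: jW.
  have w2 : `|x - l%:R / n%:R| < d1 by apply: lt_le_trans dd1.
  have := slope _ _ w1 w2.
  have le_lj : (l - j)%:R / n%:R <= l%:R / n%:R :> R.
    by rewrite ler_pM2r ?invr_gt0 // ler_nat leq_subr.
  by rewrite E; apply.
have q01 j : (j < K)%N -> 0 <= q j <= 1.
  move=> jK; rewrite /q subr_ge0 ler_pdivrMr // mul1r gerBl divr_ge0 ?(ltW pl0) //; last first.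
    by have /andP[] := pi01 ((l - j)%:R / n%:R).
  rewrite andbT -subr_ge0; have /andP[h _] := sl _ jK; apply: le_trans h.
  by rewrite mulr_ge0 ?divr_ge0 ?(ltW nR) //; lra.
(* At j = 0 every value of beta gives the same term; a keeps it close to a. *)
pose beta j : R := if j == 0%N then a else l%:R * q j / j%:R.
have sE : s = \sum_(0 <= j < K) binomial_pmf l (q j) j.
  rewrite /s (sum_window_below (fun k => binomial_pmf l (pi (k%:R / n%:R) / pl) k)) //.
  apply: eq_big_nat => j /andP[_ jK].
  by rewrite binomial_pmf_rev ?leq_subr // subKn // jl.
have qE j : beta j * j%:R / l%:R = q j.
  rewrite /beta; have [->|j0] := eqVneq j 0%N.
    by rewrite mulr0 mul0r /q subn0 divff ?subrr // gt_eqF.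
  rewrite mulfVK ?pnatr_eq0 //; by rewrite mulrAC divff ?mul1r // gt_eqF.
have s0K : 0 <= s <= K%:R by rewrite sE; exact: sum_binomial_pmf_nat_le.
have close : (M <= K)%N -> `|s - (1 - theta)^-1| <= eta.
  move=> MK; have := HM l K beta MK (leq_subr _ _).
  rewrite sE (eq_bigr (fun j => binomial_pmf l (q j) j)); last by move=> j _; rewrite qE.
  apply; last first.
    move=> j jK; have /andP[_] := q01 _ jK.
    by rewrite -qE ler_pdivrMr // mul1r.
  move=> j jK; rewrite /beta; case: eqP => [_|/eqP j0]; first by rewrite subrr normr0 ltW.
  have jR : (0 : R) < j%:R by rewrite ltr0n lt0n.
  pose rho := (l%:R / n%:R) / pl; pose S := (pl - pi ((l - j)%:R / n%:R)) / (j%:R / n%:R).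
  have -> : l%:R * q j / j%:R = rho * S.
    rewrite /rho /S /q.
    move: (pi _) => pk; field; rewrite ?gt_eqF //.
  have jn : (0 : R) < j%:R / n%:R by rewrite divr_gt0.
  have /andP[S1 S2] : a - e1 <= S <= a + e1.
    by rewrite /S ler_pdivlMr // ler_pdivrMr //; exact: sl.
  have -> : a - rho * S = (1 - rho) * S + (a - S) by ring.
  apply: le_trans (ler_normD _ _) _; rewrite normrM.
  have hS : `|S| <= a + 1.
    by rewrite ler_norml; apply/andP; clear - S1 S2 e11 e1a a0; lra.
  have haS : `|a - S| <= delta / 4.
    by rewrite ler_norml; apply/andP; clear - S1 S2 e1d; lra.
  have h3 : `|1 - rho| * `|S| <= e2 * (a + 1) by apply: ler_pM.
  have h4 : e2 * (a + 1) = delta / 4 by rewrite /e2; clear - a0; field; lra.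
  clear - h3 h4 haS del0; lra.
split => //.
  have [MK|KM] := leqP M K.
    by apply: le_trans (close MK) _; rewrite lerDr addr_ge0 // ltW.
  have KM' : K%:R <= M%:R :> R by rewrite ler_nat ltnW.
  have /andP[k1 k2] := s0K; rewrite ler_norml; apply/andP.
  clear - k1 k2 KM' L0 eta0; lra.
move=> lW2; apply: close.
have hn : n%:R^-1 < d / 2 / (M.+1)%:R by near: n; apply: invn; rewrite divr_gt0 //; lra.
have /andP[_ hlo] := window_lo_bounds n0 xd.
have hl : x - d / 2 < l%:R / n%:R.
  by move: lW2; rewrite /in_window ltr_norml => /andP[_ h]; clear - h; lra.
have hM : M.+1%:R * n%:R^-1 < d / 2 by rewrite mulrC -ltr_pdivlMr // ltr0n.
suff lM : (window_lo x d n + M <= l)%N.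
  by rewrite /K leq_subRL ?leqW // (leq_trans lM) // leqnSn.
rewrite -(ler_nat R) natrD -(ler_pM2r (_ : 0 < n%:R^-1)) ?invr_gt0 // mulrDl.
move: hM; rewrite -natr1 mulrDl mul1r => hM; clear - hM hlo hl; lra.
Unshelve. all: by end_near. Qed.

(** A hit in [W] but none in [V] forces a hit in the difference: union bound. *)
Lemma product_mass_hits_shell (R : realType) (n M : nat) (w : 'I_M -> R)
    (V W : pred nat) :
  (forall j, 0 <= w j) -> \sum_j w j = 1 -> (forall k, V k -> W k) ->
  0 <= product_mass w (fun f : {ffun 'I_n -> 'I_M} => hits W f) -
       product_mass w (fun f : {ffun 'I_n -> 'I_M} => hits V f) <=
  \sum_(k < n.+1 | W k && ~~ V k) binomial_pmf n (cum_mass w k) k.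
Proof.
move=> w0 w1 VW; rewrite subr_ge0 product_mass_le //=; last first.
  move=> f /existsP[k /andP[Vk fk]]; apply/existsP; exists k.
  by rewrite VW.
under [leRHS]eq_bigr => k _ do rewrite -(count_le_binomial n k k w1) product_massE.
rewrite !product_massE exchange_big /= -sumrB; apply: ler_sum => f _.
rewrite -mulrBl -big_distrl /=; apply: ler_wpM2r; first exact: prodr_ge0.
have s0 (P : pred 'I_n.+1) : 0 <= \sum_(k | P k) (count_le f k == k)%:R :> R.
  by apply: sumr_ge0 => k _; exact: ler0n.
have [hV|nV] := boolP (hits V f).
  apply: le_trans (s0 _); rewrite subr_le0 ler_nat; by case: (hits W f).
rewrite subr0; have [/existsP[k /andP[Wk fk]]|] := boolP (hits W f); last by [].
have nVk : ~~ V k.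
  by apply: contra nV => Vk; apply/existsP; exists k; rewrite Vk.
by rewrite (bigD1 k) ?Wk //= fk lerDl s0.
Qed.

Lemma product_mass_le1 (R : realType) (n M : nat) (w : 'I_M -> R)
    (A : pred {ffun 'I_n -> 'I_M}) :
  (forall j, 0 <= w j) -> \sum_j w j = 1 -> product_mass w A <= 1.
Proof.
move=> w0 w1; apply: le_trans (product_mass_le w0 (B := xpredT) _) _ => //.
by rewrite /product_mass -(bigA_distr_bigA (fun=> w)) big1.
Qed.

Lemma last_hit_le (R : realType) (n M : nat) (w : 'I_M -> R) (W : pred nat) (l : nat) :
  (forall j, 0 <= w j) -> \sum_j w j = 1 ->
  product_mass w (fun f : {ffun 'I_n -> 'I_M} => last_hit W l f) <=
  (W l)%:R * binomial_pmf n (cum_mass w l) l.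
Proof.
move=> w0 w1; case: (boolP (W l)) => Wl; last first.
  rewrite mul0r /product_mass big_pred0 // => f.
  by rewrite /last_hit (negbTE Wl).
rewrite mul1r -(count_le_binomial n l l w1); apply: product_mass_le => // f.
by case/and3P.
Qed.

(** [L] is the approximate number of expected hits given the last one. The estimate is accurate
    when the last hit lies in [V], and otherwise costs [C] times the mass of the shell. *)
Lemma hits_vs_expected_hits (R : realType) (pi : R -> R) (n M : nat)
    (w : 'I_M -> R) (W V : pred nat) (L C eta : R) :
  (forall j, 0 <= w j) -> \sum_j w j = 1 ->
  (forall k, (k <= n)%N -> cum_mass w k = pi (k%:R / n%:R)) ->
  (forall l, W l -> (l <= n)%N) -> 0 <= eta -> 0 <= C ->
  (forall l, W l ->
    let s := \sum_(k < l.+1 | W k)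
      binomial_pmf l (pi (k%:R / n%:R) / pi (l%:R / n%:R)) k in
    [/\ 0 < pi (l%:R / n%:R), `|s - L| <= C & V l -> `|s - L| <= eta]) ->
  `|\sum_(k < n.+1 | W k) hit_mass pi n k -
      L * product_mass w (fun f : {ffun 'I_n -> 'I_M} => hits W f)|
  <= eta + C * \sum_(k < n.+1 | W k && ~~ V k) hit_mass pi n k.
Proof.
move=> w0 w1 cw Wn eta0 C0 H.
have cW l : W l -> cum_mass w l != 0.
  by move=> Wl; rewrite cw ?Wn //; have [h _ _] := H _ Wl; rewrite gt_eqF.
pose lam l := product_mass w (fun f : {ffun 'I_n -> 'I_M} => last_hit W l f).
pose s l := \sum_(k < l.+1 | W k) binomial_pmf l (pi (k%:R / n%:R) / pi (l%:R / n%:R)) k.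
have lam0 l : 0 <= lam l by exact: product_mass_ge0.
have -> : \sum_(k < n.+1 | W k) hit_mass pi n k = \sum_(l < n.+1) lam l * s l.
  transitivity (\sum_(k < n.+1 | W k) binomial_pmf n (cum_mass w k) k).
    by apply: eq_bigr => k _; rewrite cw // -ltnS.
  rewrite (last_hit_decomposition n w1 cW); apply: eq_bigr => l _; congr (_ * _).
  apply: eq_bigr => k _; have ln : (l <= n)%N by rewrite -ltnS.
  by rewrite !cw // (leq_trans _ ln) // -ltnS.
rewrite product_mass_hits big_distrr /= -sumrB.
apply: le_trans (ler_norm_sum _ _ _) _.
apply: (@le_trans _ _ (\sum_(l < n.+1) (eta * lam l +
    (W l && ~~ V l)%:R * (C * hit_mass pi n l)))).
  apply: ler_sum => l _; rewrite [L * _]mulrC -mulrBr normrM ger0_norm // -/(lam l).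
  have ln : (l <= n)%N by rewrite -ltnS.
  have := last_hit_le n W l w0 w1; rewrite -/(lam l) cw // -/(hit_mass pi n l) => laml.
  have [Wl|nWl] := boolP (W l); last first.
    have -> : lam l = 0.
      by apply/eqP; rewrite eq_le lam0 andbT; move: laml; rewrite (negbTE nWl) mul0r.
    by rewrite mul0r mulr0 mul0r addr0.
  have [_ h1 h2] := H _ Wl; rewrite Wl mul1r in laml.
  have [Vl|nVl] := boolP (V l).
    by rewrite mul0r addr0 mulrC ler_wpM2r //; exact: h2.
  rewrite mul1r; apply: ler_wpDl; first by rewrite mulr_ge0.
  rewrite [leRHS]mulrC; apply: ler_pM => //; exact: h1.
rewrite big_split /= -!big_distrr /=; apply: lerD.
  rewrite -product_mass_hits ler_piMr //; exact: product_mass_le1.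
rewrite [in leRHS]big_mkcond /= big_distrr /=; apply: ler_sum => l _.
by case: (W l && ~~ V l); rewrite ?mul1r ?mul0r ?mulr0.
Qed.

(** The window [d] on which the return sums are accurate depends on the wanted precision, but
    the shell between [d] and [e] carries no hits in the limit, so the probability for [e] does
    not depend on [e]. *)
Lemma hits_cvg (R : realType) (pi : R -> R) (x a theta : R) :
  transversal_crossing pi x a -> 0 < theta < 1 ->
  theta * expR (- theta) = a * expR (- a) ->
  exists2 e0 : R, 0 < e0 & forall e, 0 < e <= e0 ->
  forall (M : nat -> nat) (w : forall n, 'I_(M n) -> R),
    (forall n j, 0 <= w n j) ->
    (forall n, (0 < n)%N -> \sum_j w n j = 1) ->
    (forall n k, (0 < n)%N -> (k <= n)%N -> cum_mass (w n) k = pi (k%:R / n%:R)) ->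
  product_mass (w n) (fun f : {ffun 'I_n -> 'I_(M n)} => hits (in_window x e n) f)
    @[n --> \oo] --> (1 - theta) / (a - 1).
Proof.
move=> tc t01 tE; have [/andP[x0 x1] pix a1 ss pi01] := tc.
have /andP[t0 t1] := t01.
have [e0 gr] := exists_good_radius tc; have [e00 ex ex1 _ _] := gr.
exists e0 => // e /andP[ep ee0] M w w0 w1 cw.
apply/cvgrPdist_le => eta eta0.
have eta4 : 0 < eta / 4 by lra.
have [d /andP[d0 de] [C C0 ret]] := returns_in_window tc t01 tE eta4 ep.
have d20 : 0 < d / 2 by lra.
have d2d : d / 2 <= d by lra.
have de0 : d <= e0 by apply: le_trans ee0.
have cS1 := shell_hit_mass_cvg0 a1 pi01 gr d20 d2d de0.
have cS2 := shell_hit_mass_cvg0 a1 pi01 gr d0 de ee0.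
have dd0 : 0 < d <= e0 by rewrite d0.
have cB := window_hit_mass_cvg tc gr dd0.
near=> n.
have n0 : (0 < n)%N by near: n; exists 1%N.
have hS1 : `|0 - \sum_(k < n.+1 | in_window x d n k && ~~ in_window x (d / 2) n k)
    hit_mass pi n k| <= eta / 4 / (C + 1).
  by near: n; apply: (cvgr_dist_le _ _ cS1); rewrite divr_gt0 //; lra.
have hS2 : `|0 - \sum_(k < n.+1 | in_window x e n k && ~~ in_window x d n k)
    hit_mass pi n k| <= eta / 4.
  by near: n; exact: (cvgr_dist_le _ _ cS2).
have hB : `|(a - 1)^-1 - \sum_(k < n.+1 | in_window x d n k) hit_mass pi n k| <= eta / 4.
  by near: n; exact: (cvgr_dist_le _ _ cB).
have retn : forall l, in_window x d n l ->
    let s := \sum_(k < l.+1 | in_window x d n k)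
        binomial_pmf l (pi (k%:R / n%:R) / pi (l%:R / n%:R)) k in
    [/\ 0 < pi (l%:R / n%:R), `|s - (1 - theta)^-1| <= C &
      in_window x (d / 2) n l -> `|s - (1 - theta)^-1| <= eta / 4].
  by near: n; exact: ret.
have Wn l : in_window x d n l -> (l <= n)%N.
  rewrite /in_window ltr_norml => /andP[h _].
  by rewrite -(ler_nat R) -[leRHS]mul1r -ler_pdivrMr ?ltr0n //; clear - h de0 ex1; lra.
have hE := hits_vs_expected_hits (w0 n) (w1 n n0) (fun k => @cw n k n0) Wn
  (ltW eta4) C0 retn.
have hD := product_mass_hits_shell n (w0 n) (w1 n n0)
  (fun k => @in_window_mono R x d e n k de).
move: hE hD hS1 hS2 hB.
rewrite [X in _ -> _ <= _ <= X -> _](eq_bigr (fun k : 'I_n.+1 => hit_mass pi n k)); last first.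
  by move=> k _; rewrite cw // -ltnS.
set E1 := product_mass _ _; set E2 := product_mass _ _.
set B := \sum_(k < n.+1 | in_window x d n k) _.
set S1 := \sum_(k < n.+1 | _) _; set S2 := \sum_(k < n.+1 | _) _.
move=> hE /andP[hD1 hD2] hS1 hS2 hB.
have t1' : 0 < 1 - theta by clear - t1; lra.
have CS1 : C * S1 <= eta / 4.
  move: hS1; rewrite sub0r normrN => /(le_trans (ler_norm _)) hS1.
  have C1 : 0 < C + 1 by clear - C0; lra.
  have := hS1; rewrite ler_pdivlMr // => h.
  have S10 : 0 <= S1 by apply: sumr_ge0 => k _; exact: hit_mass_ge0.
  by clear - h S10 C0; nra.
have hS2' : S2 <= eta / 4.
  by move: hS2; rewrite sub0r normrN => /(le_trans (ler_norm _)).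
(* The probability E1 of a hit in the narrow window against the expected hits. *)
have key : `|(a - 1)^-1 - (1 - theta)^-1 * E1| <= 3 / 4 * eta.
  move: hE hB; rewrite !ler_norml => /andP[k1 k2] /andP[k3 k4]; apply/andP.
  clear - k1 k2 k3 k4 CS1; lra.
have key2 : `|(1 - theta) / (a - 1) - E1| <= 3 / 4 * eta.
  have -> : (1 - theta) / (a - 1) - E1 =
    (1 - theta) * ((a - 1)^-1 - (1 - theta)^-1 * E1) by clear - t1' a1; field; lra.
  rewrite normrM gtr0_norm //; apply: le_trans key.
  by rewrite ler_piMl //; clear - t0; lra.
move: key2; rewrite !ler_norml => /andP[k1 k2]; apply/andP.
clear - k1 k2 hD1 hD2 hS2'; lra.
Unshelve. all: by end_near. Qed.

(** * The conjugate parameter *)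

Lemma xexpN_lt_low (R : realType) (s t : R) : 0 < s -> s < t -> t <= 1 ->
  s * expR (- s) < t * expR (- t).
Proof.
move=> s0 st t1.
have -> : expR (- s) = expR (t - s) * expR (- t) by rewrite -expRD; congr expR; ring.
rewrite mulrA ltr_pM2r ?expR_gt0 //.
have h : expR (s - t) >= 1 + (s - t) by exact: expR_ge1Dx.
have E : expR (t - s) * expR (s - t) = 1 by rewrite -expRD (_ : _ + _ = 0) ?expR0 //; ring.
have h1 : 1 + (s - t) < expR (s - t) by apply: expR_gt1Dx; lra.
have e0 := expR_gt0 (t - s).
have : s <= t * (1 + (s - t)) by nra.
move=> h2; have h3 : s < t * expR (s - t).
  by apply: le_lt_trans h2 _; rewrite ltr_pM2l //; lra.
have : s * expR (t - s) < t * expR (s - t) * expR (t - s) by rewrite ltr_pM2r.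
by rewrite -[X in _ < X -> _]mulrA [expR (s - t) * _]mulrC E mulr1.
Qed.

Lemma xexpN_lt_high (R : realType) (s t : R) : 1 <= s -> s < t ->
  t * expR (- t) < s * expR (- s).
Proof.
move=> s1 st.
have -> : expR (- s) = expR (t - s) * expR (- t) by rewrite -expRD; congr expR; ring.
rewrite mulrA ltr_pM2r ?expR_gt0 //.
have h1 : 1 + (t - s) < expR (t - s) by apply: expR_gt1Dx; lra.
have : t <= s * (1 + (t - s)) by nra.
by move=> h; apply: le_lt_trans h _; rewrite ltr_pM2l //; lra.
Qed.

(** With [t = 1 - v]: the difference [(1 + v) exp(-v) - (1 - v) exp v] has
    derivative [v (exp v - exp(-v))]. *)
Lemma xexpN_reflect (R : realType) (t : R) : 0 < t < 1 ->
  t * expR (- t) < (2 - t) * expR (- (2 - t)).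
Proof.
move=> /andP[t0 t1]; pose u := 1 - t.
pose phi (v : R) := (1 + v) * expR (- v) - (1 - v) * expR v.
pose dphi (v : R) := v * (expR v - expR (- v)).
have u0 : 0 < u by rewrite /u; lra.
have d (v : R) : is_derive (v : R) (1 : R) phi (dphi v).
  have dm : is_derive (v : R) (1 : R) (fun v => expR (- v)) (- expR (- v)).
    have de : is_derive (- v) (1 : R) (@expR R) (expR (- v)) by exact: is_derive_expR.
    apply: is_derive_eq.
    by rewrite mulrN1.
  apply: is_derive_eq; rewrite /dphi.
  rewrite /GRing.scale /=; ring.
have phic : {within `[0, u], continuous phi}.
  by apply: derivable_within_continuous => v _; exact: ex_derive.
have [c] := @MVT R phi dphi 0 u u0 (fun v _ => d v) phic.
rewrite in_itv /= => /andP[c0 cu].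
rewrite subr0 /phi !addr0 subr0 oppr0 expR0 mulr1 subrr subr0 => E.
have : 0 < dphi c * u.
  by rewrite mulr_gt0 // mulr_gt0 // subr_gt0 ltr_expR; lra.
rewrite -E subr_gt0 => h.
have -> : t = 1 - u by rewrite /u; ring.
have -> : 2 - (1 - u) = 1 + u by ring.
have e1 : expR (- (1 - u)) = expR u * expR (- 1) by rewrite -expRD; congr expR; ring.
have e2 : expR (- (1 + u)) = expR (- u) * expR (- 1) by rewrite -expRD; congr expR; ring.
by rewrite e1 e2 !mulrA ltr_pM2r ?expR_gt0.
Qed.

(** The bound says that [a + th > 2]: the function [t exp(-t)] is larger at [2 - th] than at [th],
    and decreases beyond 1. *)
Lemma exists_unique_conjugate (R : realType) (a : R) : 1 < a ->
  exists2 th : R,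
    unique (fun th : R => 0 < th < 1 /\ th * expR (- th) = a * expR (- a)) th &
    (1 - th) / (a - 1) < 1.
Proof.
move=> a1; pose g (t : R) := t * expR (- t).
have gc : continuous g.
  move=> t; apply: cvgM; first exact: cvg_id.
  apply: (@continuous_cvg _ _ _ _ _ _ (@expR R)); first exact: continuous_expR.
  by apply: cvgN; exact: cvg_id.
have ga0 : 0 < g a by rewrite mulr_gt0 ?expR_gt0 //; lra.
have ga1 : g a < g 1 by apply: xexpN_lt_high.
have [|th] := @IVT R g 0 1 (g a) ler01 (continuous_subspaceT gc).
  have -> : g 0 = 0 by rewrite /g mul0r.
  have g10 : 0 <= g 1 by lra.
  by rewrite min_l // max_r // !ltW.
rewrite in_itv /= => /andP[th0 th1] gth.
have th0' : 0 < th.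
  by rewrite lt_neqAle th0 andbT; apply/eqP => E; move: ga0; rewrite -gth -E /g mul0r ltxx.
have th1' : th < 1.
  by rewrite lt_neqAle th1 andbT; apply/eqP => E; move: ga1; rewrite -gth E ltxx.
exists th.
  split; first by rewrite th0' th1'.
  move=> s [/andP[s0 s1] gs].
  have [st|ts|//] := ltgtP s th.
    by have := xexpN_lt_low s0 st th1; rewrite -/(g th) gth gs ltxx.
  by have := xexpN_lt_low th0' ts (ltW s1); rewrite -/(g th) gth gs ltxx.
rewrite ltr_pdivrMr ?subr_gt0 // mul1r.
have [aS|] := leP a (2 - th); last by lra.
have := @xexpN_reflect R th; rewrite th0' th1' => /(_ isT).
rewrite -/(g th) gth -/(g (2 - th)).
move: aS; rewrite le_eqVlt => /orP[/eqP ->|aS]; first by rewrite ltxx.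
have := xexpN_lt_high (ltW a1) aS; rewrite -/(g a) -/(g (2 - th)) => /lt_trans h /h.
by rewrite ltxx.
Qed.

(** * Labelling the signals *)

Lemma measure_finite_partition (d : measure_display) (T : measurableType d)
    (R : realType) (P : probability T R) (I : finType) (L : T -> I) (A : pred I) :
  (forall i, measurable (L @^-1` [set i])) ->
  P [set w | A (L w)] = (\sum_(i | A i) P (L @^-1` [set i]))%E.
Proof.
move=> mL.
have -> : [set w | A (L w)] = \bigcup_(i in [set` A]) L @^-1` [set i].
  by apply/seteqP; split=> [w Aw|w [i Ai /= Li]]; [by exists (L w)|by rewrite Li].
rewrite measure_fin_bigcup //.
- apply/esym/bigfs; first exact: index_enum_uniq.
  by move=> i _; rewrite mem_index_enum.
- apply/trivIsetP => i j _ _ ij; apply/seteqP; split=> // w [/= Li Lj].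
  by move: ij; rewrite -Li -Lj eqxx.
Qed.

(** The least [k <= n] at which the signal value [y] is counted, and [n + 1] if there is none. *)
Definition threshold_label (R : realType) (r c : R) (n : nat) (y : R) : 'I_n.+2 :=
  inord (find (fun k => r <= y + c * (k%:R / n%:R)) (iota 0 n.+1)).

Lemma threshold_label_le (R : realType) (r c : R) (n k : nat) (y : R) :
  0 < c -> (k <= n)%N ->
  (threshold_label r c n y <= k)%N = (r <= y + c * (k%:R / n%:R)).
Proof.
move=> c0 kn; rewrite /threshold_label.
set a := fun k => _; have fs := find_size a (iota 0 n.+1).
rewrite size_iota in fs; rewrite inordK ?ltnS //.
apply/idP/idP => [fk|ak].
  have fn : (find a (iota 0 n.+1) < n.+1)%N by rewrite ltnS (leq_trans fk).
  have : has a (iota 0 n.+1) by rewrite has_find size_iota.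
  move=> /(nth_find 0%N); rewrite nth_iota // add0n /a => /le_trans; apply.
  by rewrite lerD2l ler_pM2l // ler_wpM2r ?invr_ge0 // ler_nat.
rewrite leqNgt; apply/negP => kf.
have := before_find 0%N kf; rewrite nth_iota ?ltnS // add0n.
by rewrite /a ak.
Qed.

Lemma measurable_threshold_label (R : realType) (r c : R) (n : nat) (j : 'I_n.+2) :
  0 < c -> measurable [set y : R | threshold_label r c n y = j].
Proof.
move=> c0.
have mle k : measurable [set y : R | (threshold_label r c n y <= k)%N].
  have [kn|nk] := leqP k n; last first.
    rewrite (_ : [set y | _] = setT) //; apply/seteqP; split=> // y _ /=.
    by apply: leq_trans nk; rewrite -ltnS.
  rewrite (_ : [set y | _] = `[r - c * (k%:R / n%:R), +oo[%classic) //.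
  apply/seteqP; split=> y /=; rewrite threshold_label_le // in_itv /= andbT.
    by rewrite lerBlDr.
  by rewrite lerBlDr.
have [j0|j0] := posnP (nat_of_ord j).
  rewrite (_ : [set y | _] = [set y : R | (threshold_label r c n y <= 0)%N]) //.
  apply/seteqP; split=> y /= => [->|]; first by rewrite j0.
  by rewrite leqn0 => /eqP l0; apply/val_inj; rewrite /= l0 j0.
rewrite (_ : [set y | _] = [set y : R | (threshold_label r c n y <= j)%N] `\`
  [set y : R | (threshold_label r c n y <= j.-1)%N]); first exact: measurableD.
apply/seteqP; split=> y /= => [->|[h1 h2]].
  by split => //; apply/negP; rewrite -ltnNge prednK.
apply/val_inj/eqP; rewrite /= eqn_leq h1 /=.
by move/negP: h2; rewrite -ltnNge prednK.
Qed.

Definition label_mass (R : realType) (d : measure_display) (T : measurableType d)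
    (P : probability T R) (r c : R) (Y0 : {RV P >-> R}) (n : nat) (j : 'I_n.+2) : R :=
  fine (P (Y0 @^-1` [set y | threshold_label r c n y = j])).

Lemma measurable_label_preimage (R : realType) (d : measure_display)
    (T : measurableType d) (P : probability T R) (r c : R) (Y0 : {RV P >-> R})
    (n : nat) (j : 'I_n.+2) : 0 < c ->
  measurable (Y0 @^-1` [set y | threshold_label r c n y = j]).
Proof.
move=> c0; rewrite -[X in measurable X]setTI.
by apply: measurable_funP => //; exact: measurable_threshold_label.
Qed.

Lemma label_massE (R : realType) (d : measure_display)
    (T : measurableType d) (P : probability T R) (r c : R) (Y0 : {RV P >-> R})
    (n : nat) (j : 'I_n.+2) : 0 < c ->
  P (Y0 @^-1` [set y | threshold_label r c n y = j]) = (label_mass r c Y0 j)%:E.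
Proof.
by move=> c0; rewrite /label_mass fineK // fin_num_measure //; exact: measurable_label_preimage.
Qed.

Lemma sum_label_mass (R : realType) (d : measure_display)
    (T : measurableType d) (P : probability T R) (r c : R) (Y0 : {RV P >-> R})
    (n : nat) (A : pred 'I_n.+2) : 0 < c ->
  P [set w | A (threshold_label r c n (Y0 w))] =
    (\sum_(j | A j) label_mass r c Y0 j)%:E.
Proof.
move=> c0.
rewrite (measure_finite_partition P (L := fun w => threshold_label r c n (Y0 w))).
  by rewrite -sumEFin; apply: eq_bigr => j _; rewrite -label_massE.
by move=> j; exact: (@measurable_label_preimage R d T P r c Y0 n j c0).
Qed.

Definition level_mass (R : realType) (d : measure_display) (T : measurableType d)
    (P : probability T R) (r c : R) (Y0 : {RV P >-> R}) (y : R) : R :=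
  fine (P [set w | r <= Y0 w + c * y]).

Lemma cum_label_mass (R : realType) (d : measure_display)
    (T : measurableType d) (P : probability T R) (r c : R) (Y0 : {RV P >-> R})
    (n k : nat) : 0 < c -> (k <= n)%N ->
  cum_mass (label_mass r c Y0 (n := n)) k = level_mass r c Y0 (k%:R / n%:R).
Proof.
move=> c0 kn; rewrite /level_mass /cum_mass.
rewrite (_ : [set w | _] =
  [set w | (fun j : 'I_n.+2 => (j <= k)%N) (threshold_label r c n (Y0 w))]).
  by rewrite (@sum_label_mass R d T P r c Y0 n (fun j => (j <= k)%N)).
by apply/seteqP; split => w /=; rewrite threshold_label_le.
Qed.

Lemma near_event_hits (R : realType) (T : Type) (r c : R) (Y : nat -> T -> R)
    (x : R) (n : nat) (eps : R) : 0 < c ->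
  near_event r c Y x n eps =
  [set w | hits (in_window x eps n)
     [ffun i : 'I_n => threshold_label r c n (Y i w)]].
Proof.
move=> c0.
have GE (k : nat) w : (k <= n)%N -> G r c Y n k w =
    count_le [ffun i : 'I_n => threshold_label r c n (Y i w)] k.
  move=> kn; rewrite /G /count_le -sum1_card big_mkcond /=.
  by apply: eq_bigr => i _; rewrite ffunE threshold_label_le // inE.
apply/seteqP; split=> w.
  move=> [k [/andP[k0 kn] Gk] kx].
  case: k k0 kn Gk kx => // k _ kn Gk kx.
  have kn' : (k <= n)%N by [].
  apply/existsP; exists (Ordinal (kn' : (k < n.+1)%N)) => /=.
  rewrite -GE //; apply/andP; split; first exact: kx.
  by apply/eqP; move: Gk => [].
move=> /existsP[k /andP[kx /eqP kk]].
have kn : (k <= n)%N by rewrite -ltnS.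
by exists (Posz k) => //; split => //; rewrite GE // kk.
Qed.

(** Independence gives the probability of each pattern of labels as a product. *)
Lemma prob_near_event (R : realType) (d : measure_display) (T : measurableType d)
    (P : probability T R) (r c : R) (Y : nat -> {RV P >-> R}) (x : R) (n : nat)
    (eps : R) : 0 < c -> iid_RVs Y ->
  P (near_event r c Y x n eps) =
  (product_mass (label_mass r c (Y 0%N) (n := n))
     (fun f : {ffun 'I_n -> 'I_n.+2} => hits (in_window x eps n) f))%:E.
Proof.
move=> c0 [indep ident].
pose L w := [ffun i : 'I_n => threshold_label r c n (Y i w)].
(* Independence is stated for sets indexed by all naturals: the real line beyond n. *)
pose A (f : {ffun 'I_n -> 'I_n.+2}) (i : nat) : set R :=
  if insub i is Some o then [set y | threshold_label r c n y = f o] else setT.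
have mA f i : measurable (A f i).
  by rewrite /A; case: insub => // o; exact: measurable_threshold_label.
have LA f : L @^-1` [set f] = \bigcap_(i in [set` iota 0 n]) (Y i @^-1` A f i).
  apply/seteqP; split=> w.
    move=> /= <- i /=; rewrite mem_iota add0n /= => i_n.
    by rewrite /A insubT /= /L ffunE.
  move=> H; apply/ffunP => i; rewrite /L ffunE.
  have /(_ _)/= := H i; rewrite mem_iota /= add0n ltn_ord => /(_ isT).
  by rewrite /A valK.
rewrite near_event_hits // (measure_finite_partition P (L := L)); last first.
  move=> f; rewrite LA; apply: bigcap_measurableType => i _.
  rewrite -[X in measurable X]setTI; exact: measurable_funP.
rewrite /product_mass -sumEFin; apply: eq_bigr => f _.
rewrite LA indep ?iota_uniq // -[X in iota 0 X]subn0 big_mkord -prodEFin.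
apply: eq_bigr => i _; rewrite -label_massE // /A valK.
apply: (ident i 0%N); exact: measurable_threshold_label.
Qed.

(** * The distribution function near the crossing *)

Lemma cdf_fin_num (R : realType) (d : measure_display) (T : measurableType d)
    (P : probability T R) (Y0 : {RV P >-> R}) (u : R) : cdf Y0 u \is a fin_num.
Proof. by rewrite /cdf; apply: fin_num_measure; exact: measurable_itv. Qed.

Lemma cdf_increment_bounds (R : realType) (d : measure_display)
    (T : measurableType d) (P : probability T R) (Y0 : {RV P >-> R}) (f : R -> R)
    (u v m M : R) :
  continuous_density (cdf Y0) f -> u <= v ->
  (forall t, u < t <= v -> m <= f t <= M) ->
  m * (v - u) <= fine (cdf Y0 v) - fine (cdf Y0 u) <= M * (v - u).
Proof.
move=> [mf f0 _ FE] uv fmM.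
have mfE D : measurable_fun D (EFin \o f).
  by apply/measurable_EFinP; exact: measurable_funS mf.
have f0E t : (0 <= (f t)%:E)%E by rewrite lee_fin.
have leb : lebesgue_measure `]u, v]%classic = (v - u)%:E :> \bar R.
  rewrite lebesgue_measure_itv /= lte_fin.
  by move: uv; rewrite le_eqVlt => /orP[/eqP ->|->] //; rewrite ltxx subrr.
pose I := (\int[lebesgue_measure]_(t in `]u, v]) (f t)%:E)%E.
have FI : (cdf Y0 v = cdf Y0 u + I)%E.
  rewrite !FE.
  have -> : `]-oo, v]%classic = `]-oo, u] `|` `]u, v] :> set R.
    by apply: itv_bndbnd_setU; rewrite bnd_simp.
  rewrite ge0_integral_setU //=; first exact: mfE.
  apply/disj_setPS => t [] /=; rewrite !in_itv /= => tu /andP[ut _].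
  by move: ut; rewrite ltNge tu.
have I0 : (0 <= I)%E by exact: integral_ge0.
have Ifin : I \is a fin_num.
  have := cdf_fin_num Y0 v; rewrite FI fin_numD => /andP[].
  by [].
have -> : fine (cdf Y0 v) - fine (cdf Y0 u) = fine I.
  by rewrite FI fineD ?cdf_fin_num // addrAC subrr add0r.
have IM : (I <= (M * (v - u))%:E)%E.
  move: uv; rewrite le_eqVlt => /orP[/eqP uv|uv].
    by rewrite /I uv set_itv_ge ?bnd_simp ?ltxx // integral_set0 subrr mulr0.
  have M0 : 0 <= M.
    have /andP[_] : m <= f v <= M by apply: fmM; rewrite uv lexx.
    exact: le_trans.
  rewrite EFinM -leb -integral_cst //; apply: ge0_le_integral => //=; try exact: mfE.
  by move=> t; rewrite ?in_itv /= lee_fin => /fmM /andP[].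
have mI : ((m * (v - u))%:E <= I)%E.
  have [m0|m0] := leP 0 m; last first.
    apply: le_trans I0; rewrite lee_fin mulr_le0_ge0 ?subr_ge0 //; exact: ltW.
  rewrite EFinM -leb -integral_cst //; apply: ge0_le_integral => //=; try exact: mfE.
  by move=> t; rewrite ?in_itv /= lee_fin => /fmM /andP[].
by rewrite -!lee_fin fineK // mI IM.
Qed.

(** The negative half-line is null, and a law with a density has no atom at 0. *)
Lemma cdf_le0 (R : realType) (d : measure_display) (T : measurableType d)
    (P : probability T R) (Y0 : {RV P >-> R}) (f : R -> R) (u : R) :
  (forall w, 0 <= Y0 w) -> continuous_density (cdf Y0) f -> u <= 0 ->
  cdf Y0 u = 0%E.
Proof.
move=> Y0ge [mf f0 _ FE] u0.
have mfE D : measurable_fun D (EFin \o f).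
  by apply/measurable_EFinP; exact: measurable_funS mf.
have f0E t : (0 <= (f t)%:E)%E by rewrite lee_fin.
have neg v : v < 0 -> cdf Y0 v = 0%E.
  move=> v0; rewrite /cdf /distribution /= /pushforward.
  rewrite (_ : _ @^-1` _ = set0) ?measure0 //.
  apply/seteqP; split=> // w /=; rewrite in_itv /= => h.
  by have := Y0ge w; rewrite leNgt (le_lt_trans h v0).
have F0 : cdf Y0 0 = 0%E.
  rewrite FE -integral_itv_bndo_bndc //.
  pose F n : set R := `]-oo, - n.+1%:R^-1]%classic.
  have -> : `]-oo, 0[%classic = \bigcup_n F n.
    apply/seteqP; split=> t /=; last first.
      move=> [n _]; rewrite /F /= !in_itv /= => /le_lt_trans; apply.
      by rewrite oppr_lt0 invr_gt0.
    rewrite in_itv /= => t0; have t0' : 0 < - t by rewrite oppr_gt0.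
    exists (Num.truncn (- t)^-1) => //; rewrite /F /= in_itv /=.
    rewrite lerNr invf_ple ?posrE //; apply/ltW; exact: truncnS_gt.
  have cv : (\int[lebesgue_measure]_(t in F n) (f t)%:E)%E
      @[n --> \oo] --> (\int[lebesgue_measure]_(t in \bigcup_n
        F n) (f t)%:E)%E.
    apply: ge0_nondecreasing_set_cvg_integral.
    - move=> p q pq; apply/subsetPset => t; rewrite /F /= !in_itv /= => /le_trans; apply.
      by rewrite lerN2 lef_pV2 ?posrE // ler_nat.
    - by move=> i; exact: measurable_itv.
    - by move=> i; exact: mfE.
    - by move=> i t _; exact: f0E.
  have FE0 n : (\int[lebesgue_measure]_(t in F n) (f t)%:E)%E = 0%E.
    by rewrite /F -FE neg // oppr_lt0 invr_gt0.
  apply: (cvg_unique _ cv) => //.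
  by apply: cvg_near_cst; apply: nearW => n; exact: FE0.
have : (cdf Y0 u <= cdf Y0 0)%E.
  by apply: cdf_nondecreasing.
by rewrite F0 => h; apply/eqP; rewrite eq_le h /= cdf_ge0.
Qed.

(** A density bounded to the left of [u] excludes an atom at [u]. *)
Lemma prob_ge_cdf (R : realType) (d : measure_display) (T : measurableType d)
    (P : probability T R) (Y0 : {RV P >-> R}) (f : R -> R) (u h K : R) :
  continuous_density (cdf Y0) f -> 0 < h ->
  (forall t, u - h < t <= u -> f t <= K) ->
  fine (P [set w | u <= Y0 w]) = 1 - fine (cdf Y0 u).
Proof.
move=> cd h0 fK.
have f0 t : 0 <= f t by have [_ + _ _] := cd; exact.
have mP (A : set R) : measurable A -> measurable (Y0 @^-1` A).
  by move=> mA; rewrite -[X in measurable X]setTI; exact: measurable_funP.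
have mlt : measurable [set w | Y0 w < u].
  rewrite (_ : [set w | _] = Y0 @^-1` `]-oo, u[); first exact: mP (measurable_itv _).
  by apply/seteqP; split=> w /=; rewrite in_itv.
have mge : measurable [set w | u <= Y0 w].
  rewrite (_ : [set w | _] = Y0 @^-1` `[u, +oo[); first exact: mP (measurable_itv _).
  by apply/seteqP; split=> w /=; rewrite in_itv /= andbT.
pose H := fine (P [set w | Y0 w < u]).
have -> : fine (P [set w | u <= Y0 w]) = 1 - H.
  rewrite (_ : [set w | _] = ~` [set w | Y0 w < u]).
    by rewrite probability_setC // fineB ?fin_num_measure.
  by apply/seteqP; split=> w /=; rewrite leNgt => /negP.
have cdfE v : cdf Y0 v = P [set w | Y0 w <= v].
  have -> : [set w | Y0 w <= v] = Y0 @^-1` `]-oo, v].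
    by apply/seteqP; split=> w /=; rewrite in_itv.
  reflexivity.
have mle v : measurable [set w | Y0 w <= v].
  rewrite (_ : [set w | _] = Y0 @^-1` `]-oo, v]); first exact: mP (measurable_itv _).
  by apply/seteqP; split=> w /=; rewrite in_itv.
have Hle : H <= fine (cdf Y0 u).
  rewrite /H fine_le ?cdf_fin_num ?fin_num_measure // cdfE le_measure ?inE //.
  by move=> w /= /ltW.
have leH v : v < u -> fine (cdf Y0 v) <= H.
  move=> vu; rewrite /H fine_le ?cdf_fin_num ?fin_num_measure // cdfE le_measure ?inE //.
  by move=> w /= /le_lt_trans; apply.
have K0 : 0 <= K by apply: le_trans (fK u _) => //; rewrite lexx andbT; lra.
congr (1 - _); apply/eqP; rewrite eq_le Hle /=; apply/ler_addgt0Pr => e e0.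
pose k := Num.min (h / 2) (e / (K + 1)).
have k0 : 0 < k by rewrite lt_min !divr_gt0 //; lra.
have [kh ke] : k <= h / 2 /\ k <= e / (K + 1) by rewrite /k !ge_min !lexx orbT.
have := leH (u - k); have uk : u - k < u by lra.
move=> /(_ uk).
have := @cdf_increment_bounds _ _ _ P Y0 f (u - k) u 0 K cd (ltW uk).
have fb t : u - k < t <= u -> 0 <= f t <= K.
  by move=> /andP[t1 t2]; rewrite f0 /=; apply: fK; apply/andP; lra.
move=> /(_ fb) /andP[_]; rewrite (_ : u - (u - k) = k) => [h1 h2|]; last by ring.
have : K * k <= e.
  rewrite ler_pdivlMr in ke; last by lra.
  nra.
lra.
Qed.

(** At [y = x] the threshold [r - c x] is positive, since [x < 1]; the density is therefore
    continuous there, and its value times [c] is the strict slope. *)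
Lemma level_mass_crossing (R : realType) (d : measure_display)
    (T : measurableType d) (P : probability T R) (r c : R) (Y0 : {RV P >-> R})
    (f : R -> R) (x alpha : R) :
  0 < c -> (forall w, 0 <= Y0 w) -> continuous_density (cdf Y0) f -> 0 < x < 1 ->
  (x%:E + cdf Y0 (r - c * x) = 1%:E)%E -> alpha = c * f (r - c * x) -> 1 < alpha ->
  transversal_crossing (level_mass r c Y0) x alpha.
Proof.
move=> c0 Yge cd x01 xE aE a1; have /andP[x0 x1] := x01.
have [mf f0 cf FE] := cd.
set u0 := r - c * x in xE aE.
have Fu0 : fine (cdf Y0 u0) = 1 - x.
  have := xE; rewrite -(fineK (cdf_fin_num Y0 u0)) -EFinD => -[E].
  by rewrite -E addrAC subrr add0r.
have u00 : 0 < u0.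
  rewrite ltNge; apply/negP => u0le; move: Fu0.
  by rewrite (cdf_le0 Yge cd u0le) /= => E; lra.
have cfu : f t @[t --> u0] --> f u0.
  move/continuous_within_itvcyP: cf => [cin _]; apply: cin.
  by rewrite in_itv /= u00.
have near_f e : 0 < e -> exists2 h, 0 < h & forall t, `|u0 - t| < h ->
    f u0 - e <= f t <= f u0 + e.
  move=> e0; have : \forall t \near u0, `|f u0 - f t| <= e by exact: (cvgr_dist_le _ _ cfu).
  move=> /nbhs_ballP[h /= h0 H].
  exists h => // t /H /=; rewrite ler_norml => /andP[? ?]; apply/andP; lra.
have levelE : exists2 h, 0 < h & forall y, `|x - y| < h ->
    level_mass r c Y0 y = 1 - fine (cdf Y0 (r - c * y)).
  have [h h0 H] := near_f _ ltr01.
  exists (h / (2 * c)) => [|y]; first by rewrite divr_gt0 // mulr_gt0.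
  rewrite ltr_pdivlMr ?mulr_gt0 // => yh.
  have yh' : `|c * (x - y)| < h / 2 by rewrite normrM gtr0_norm // mulrC; lra.
  rewrite /level_mass -(@prob_ge_cdf _ _ _ P Y0 f (r - c * y) (h / 2) (f u0 + 1) cd).
  - by congr (fine (P _)); apply/seteqP; split=> w /=; rewrite lerBlDr.
  - by lra.
  - move=> t /andP[t1 t2].
    have /H/andP[] // : `|u0 - t| < h.
    move: yh'; rewrite !ltr_norml /u0 => /andP[? ?]; apply/andP; lra.
have [h1 h10 lE] := levelE.
split => //.
- by rewrite lE ?subrr ?normr0 // -/u0 Fu0; ring.
- move=> e e0; have [h h0 H] := near_f (e / c) (divr_gt0 e0 c0).
  exists (Num.min h1 (h / c)) => [|y z]; first by rewrite lt_min h10 divr_gt0.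
  rewrite !lt_min => /andP[y1 y2] /andP[z1 z2] yz.
  rewrite !lE // (_ : 1 - _ - (1 - _) =
    fine (cdf Y0 (r - c * y)) - fine (cdf Y0 (r - c * z))); last by ring.
  have uv : r - c * z <= r - c * y by rewrite lerD2l lerN2 ler_pM2l.
  have y3 : `|c * (x - y)| < h by rewrite normrM gtr0_norm // mulrC -ltr_pdivlMr.
  have z3 : `|c * (x - z)| < h by rewrite normrM gtr0_norm // mulrC -ltr_pdivlMr.
  have fb t : r - c * z < t <= r - c * y -> f u0 - e / c <= f t <= f u0 + e / c.
    move=> /andP[t1 t2]; apply: H; move: y3 z3.
    rewrite !ltr_norml /u0 => /andP[? ?] /andP[? ?]; apply/andP; lra.
  have := cdf_increment_bounds cd uv fb.
  have -> : r - c * y - (r - c * z) = c * (z - y) by ring.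
  have -> : (f u0 - e / c) * (c * (z - y)) = (alpha - e) * (z - y).
    by rewrite aE; field; lra.
  by have -> : (f u0 + e / c) * (c * (z - y)) = (alpha + e) * (z - y)
    by rewrite aE; field; lra.
- move=> y; rewrite /level_mass.
  have mA : measurable [set w | r <= Y0 w + c * y].
    rewrite (_ : [set w | _] = Y0 @^-1` `[r - c * y, +oo[).
      by rewrite -[X in measurable X]setTI; apply: measurable_funP => //; exact: measurable_itv.
    by apply/seteqP; split=> w /=; rewrite in_itv /= andbT lerBlDr.
  by rewrite fine_ge0 //= -lee_fin fineK ?probability_le1 // fin_num_measure.
Qed.

(** * The limit *)

Theorem proposition6p7 (R : realType) (d : measure_display)
    (T : measurableType d) (P : probability T R)
    (r c : R) (c_gt0 : 0 < c)
    (Y : nat -> {RV P >-> R})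
    (Y_ge0 : forall (i : nat) (w : T), 0 <= Y i w)
    (Y_iid : iid_RVs Y)
    (f : R -> R) (f_density : continuous_density (cdf (Y 0%N)) f)
    (x : R) (x01 : 0 < x < 1)
    (x_eq : (x%:E + cdf (Y 0%N) (r - c * x) = 1%:E)%E)
    (alpha : R) (alphaE : alpha = c * f (r - c * x)) (alpha_gt1 : 1 < alpha) :
  exists theta : R,
    [/\ unique (fun th : R =>
          0 < th < 1 /\ th * expR (- th) = alpha * expR (- alpha)) theta,
        (\forall eps \near (0 : R)^'+,
          cvgn (fun n : nat => P (near_event r c Y x n eps))),
        (fun eps : R => limn (fun n : nat => P (near_event r c Y x n eps)))
          @ (0 : R)^'+ --> (((1 - theta) / (alpha - 1))%:E : \bar R) &
        (1 - theta) / (alpha - 1) < 1].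
Proof.
have [theta thU lt1] := exists_unique_conjugate alpha_gt1.
have [[th01 thE] _] := thU.
have tc := level_mass_crossing c_gt0 (Y_ge0 0%N) f_density x01 x_eq alphaE alpha_gt1.
have [e0 e00 hc] := hits_cvg tc th01 thE.
have lim_eps : \forall eps \near (0 : R)^'+,
    P (near_event r c Y x n eps) @[n --> \oo] --> (((1 - theta) / (alpha - 1))%:E : \bar R).
  near=> eps.
  have e01 : 0 < eps <= e0.
    by apply/andP; split; near: eps; [exact: nbhs_right_gt|exact: nbhs_right_le].
  under eq_fun do rewrite prob_near_event //.
  apply: cvg_EFin; first by near=> n.
  apply: (hc eps e01 (fun n => n.+2) (fun n => label_mass r c (Y 0%N) (n := n))).
  - by move=> n j; exact: fine_ge0.
  - move=> n _; apply: EFin_inj; rewrite -(sum_label_mass _ _ xpredT) //.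
    by rewrite -[RHS](probability_setT P); congr (P _); apply/seteqP.
  - by move=> n k _ kn; exact: cum_label_mass.
exists theta; split => //.
- by apply: filterS lim_eps => eps H; apply/cvg_ex; exists (((1 - theta) / (alpha - 1))%:E).
- apply: cvg_near_cst; apply: filterS lim_eps => eps H.
  exact: cvg_lim H.
Unshelve. all: by end_near. Qed.
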